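(* Let $X$ be a $C^1$ vector field on $M$ with flow $\{X_t\}$, and let $\Lambda\subset M$ be a compact invariant set of $X$ such that every singularity of $X$ in $\Lambda$ is hyperbolic. Suppose that there exists a continuous $DX_t$-invariant splitting of the tangent bundle over $\Lambda$, $T_{\Lambda}M = E \oplus F$ (with $E_x\neq\{0\}$ and $F_x\neq\{0\}$ for every $x\in\Lambda$), where $E$ is uniformly contracted, $F$ is sectionally expanding, and for some constants $C,\lambda > 0$ we have $$\|DX_t|_{E_\sigma}\|\cdot\|DX_{-t}|_{F_\sigma}\| < C e^{-\lambda t}\quad\text{for all singularities } \sigma\in\Lambda \text{ of } X \text{ and all } t\ge 0.$$ Then $T_{\Lambda}M = E \oplus F$ is a dominated splitting.
   Context: $M$ is a connected compact finite-dimensional Riemannian manifold of dimension $n\ge 3$, with or without boundary; $X$ is inwardly transverse to $\partial M$ if $\partial M\neq\emptyset$; $\{X_t\}$ is the flow generated by $X$, and $DX_t$ its derivative. A set $\Lambda$ is invariant if $X_t(\Lambda)=\Lambda$ for all $t\in\mathbb{R}$. A singularity is a point $\sigma$ with $X(\sigma)=0$; it is hyperbolic if all eigenvalues of $DX(\sigma)$ have nonzero real part. A splitting is $DX_t$-invariant if $DX_t\cdot E_x=E_{X_t(x)}$ and $DX_t\cdot F_x=F_{X_t(x)}$ for all $x\in\Lambda$, $t\in\mathbb{R}$. A $DX_t$-invariant subbundle $E$ is uniformly contracted if there are $C,\lambda>0$ with $\|DX_t|_{E_x}\|\le Ce^{-\lambda t}$ for all $x\in\Lambda$, $t\ge0$.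 A $DX_t$-invariant subbundle $F\subset T_\Lambda M$ is sectionally expanding if $\dim F_x\ge2$ is constant for $x\in\Lambda$ and there are $C,\lambda>0$ such that for every $x\in\Lambda$ and every two-dimensional linear subspace $L_x\subset F_x$ one has $|\det(DX_t|_{L_x})|>Ce^{\lambda t}$ for all $t>0$. A dominated splitting over a compact invariant set $\Lambda$ is a continuous $DX_t$-invariant splitting $T_\Lambda M=E\oplus F$ with $E_x\ne\{0\}$, $F_x\neq\{0\}$ for every $x\in\Lambda$, such that there are $K,\lambda>0$ with $\|DX_t|_{E_x}\|\cdot\|DX_{-t}|_{F_{X_t(x)}}\|<Ke^{-\lambda t}$ for all $x\in\Lambda$ and all $t>0$. *)

(* Defs.v *)
From HB Require Import structures.
From mathcomp Require Import all_boot all_order all_algebra.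
From mathcomp Require Import complex.
From mathcomp Require Import all_classical all_reals all_analysis.
Set Implicit Arguments.
Unset Strict Implicit.
Unset Printing Implicit Defensive.
Import Order.TTheory GRing.Theory Num.Theory.
Import numFieldNormedType.Exports.
Local Open Scope classical_set_scope.
Local Open Scope ring_scope.

(* Differential calculus relative to a set.  Vectors are rows, and a linear   *)
(* map acts by right multiplication by its matrix.  The sets S used below are *)
(* relatively open in a closed half-space, or images of such sets under       *)
(* diffeomorphisms, so that derivatives relative to S are unique.             *)

Definition is_deriv_within (R : realType) (U V : normedModType R) (S : set U)
    (f : U -> V) (a : U) (L : U -> V) : Prop :=
  forall e : R, 0 < e ->
    \forall y \near within S (nbhs a), `|f y - f a - L (y - a)| <= e * `|y - a|.

Definition is_jacobian (R : realType) (p q : nat) (S : set 'rV[R]_p)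
    (f : 'rV[R]_p -> 'rV[R]_q) (a : 'rV[R]_p) (J : 'M[R]_(p, q)) : Prop :=
  is_deriv_within S f a (fun h => h *m J).

(* Junk value 0 where f is not differentiable. *)
Definition jacobian_within (R : realType) (p q : nat) (S : set 'rV[R]_p)
    (f : 'rV[R]_p -> 'rV[R]_q) (a : 'rV[R]_p) : 'M[R]_(p, q) :=
  xget 0 [set J | is_jacobian S f a J].

(* f is of class C^k on S; df i is the i-th partial derivative. *)
Fixpoint Ck (R : realType) (n : nat) (V : normedModType R) (k : nat)
    (S : set 'rV[R]_n) (f : 'rV[R]_n -> V) {struct k} : Prop :=
  match k with
  | 0%N => {within S, continuous f}
  | k'.+1 => exists df : 'I_n -> 'rV[R]_n -> V,
      (forall a, S a ->
         is_deriv_within S f a (fun h => \sum_(i < n) h ord0 i *: df i a)) /\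
      (forall i, Ck k' S (df i))
  end.

Definition smooth (R : realType) (n : nat) (V : normedModType R)
    (S : set 'rV[R]_n) (f : 'rV[R]_n -> V) : Prop := forall k, Ck k S f.

(* The model space is {v | v_0 >= 0}; the coordinate of index 0 exists as     *)
(* soon as 0 < n.                                                             *)
Definition halfspace (R : realType) (n : nat) : set 'rV[R]_n :=
  [set v | forall k : 'I_n, k = 0%N :> nat -> 0 <= v ord0 k].

(* Smooth n-manifold with (possibly empty) boundary.  chart i is meaningful   *)
(* on chart_dom i only, and chart_inv i on its image.  Each point x carries a *)
(* preferred chart pref x, and the tangent space T_x M is 'rV[R]_n, read      *)
(* through the coordinates of pref x.                                         *)
Record smooth_atlas (R : realType) (n : nat) (M : topologicalType) := SmoothAtlas {
  chart_index : Type ;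
  chart_dom : chart_index -> set M ;
  chart : chart_index -> M -> 'rV[R]_n ;
  chart_inv : chart_index -> 'rV[R]_n -> M ;
  chart_dom_open : forall i, open (chart_dom i) ;
  chart_image_open : forall i, exists2 O : set 'rV[R]_n,
    open O & chart i @` chart_dom i = O `&` @halfspace R n ;
  chartK : forall i x, chart_dom i x -> chart_inv i (chart i x) = x ;
  chart_continuous : forall i, {within chart_dom i, continuous (chart i)} ;
  chart_inv_continuous : forall i,
    {within chart i @` chart_dom i, continuous (chart_inv i)} ;
  chart_smooth : forall i j,
    smooth (chart i @` (chart_dom i `&` chart_dom j)) (chart j \o chart_inv i) ;
  pref : M -> chart_index ;
  pref_dom : forall x, chart_dom (pref x) x
}.

Section Manifold.
Variables (R : realType) (n : nat) (M : topologicalType).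
Variable A : smooth_atlas R n M.
Implicit Types (i j : chart_index A) (x y : M).

Definition chart_image i : set 'rV[R]_n := chart i @` chart_dom i.

Definition boundary : set M :=
  [set x | exists2 i : chart_index A, chart_dom i x &
             forall k : 'I_n, k = 0%N :> nat -> chart i x ord0 k = 0].

(* Domain and Jacobian at x of a partially defined map f : S -> M, read in    *)
(* chart i at the source and chart j at the target.                           *)
Definition local_dom (S : set M) (f : M -> M) i j : set 'rV[R]_n :=
  chart i @` (chart_dom i `&` S `&` f @^-1` chart_dom j).

Definition tangent_map (S : set M) (f : M -> M) i j x : 'M[R]_n :=
  jacobian_within (local_dom S f i j) (chart j \o f \o chart_inv i) (chart i x).

(* Change of coordinates, from chart i to chart j, of tangent vectors at x. *)
Definition transition i j x : 'M[R]_n := tangent_map setT id i j x.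

(* g x is the Gram matrix of the inner product of T_x M. *)
Definition metric_rep (g : M -> 'M[R]_n) i (a : 'rV[R]_n) : 'M[R]_n :=
  let x := chart_inv i a in
  let T := transition i (pref A x) x in T *m g x *m T^T.

Definition riemannian_metric (g : M -> 'M[R]_n) : Prop :=
  [/\ forall x, (g x)^T = g x,
      forall x (v : 'rV[R]_n), v != 0 -> 0 < (v *m g x *m v^T) ord0 ord0 &
      forall i, smooth (chart_image i) (metric_rep g i)].

Definition vf_rep (X : M -> 'rV[R]_n) i (a : 'rV[R]_n) : 'rV[R]_n :=
  let x := chart_inv i a in X x *m transition (pref A x) i x.

Definition C1_vector_field (X : M -> 'rV[R]_n) : Prop :=
  forall i, Ck 1 (chart_image i) (vf_rep X i).

Definition inwardly_transverse (X : M -> 'rV[R]_n) : Prop :=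
  forall i x (k : 'I_n), k = 0%N :> nat -> chart_dom i x ->
    chart i x ord0 k = 0 -> 0 < vf_rep X i (chart i x) ord0 k.

(* The linear part DX(s) : T_s M -> T_s M, for a singularity s of X. *)
Definition vf_linear_part (X : M -> 'rV[R]_n) (s : M) : 'M[R]_n :=
  let i := pref A s in jacobian_within (chart_image i) (vf_rep X i) (chart i s).

Definition singularity (X : M -> 'rV[R]_n) (s : M) : Prop := X s = 0.

Definition hyperbolic (X : M -> 'rV[R]_n) (s : M) : Prop :=
  forall z : R[i],
    eigenvalue (map_mx (real_complex R) (vf_linear_part X s)) z ->
    complex.Re z != 0.

(* phi t x = X_t(x), which is defined for x in D t.  When M has a boundary,   *)
(* X_t is only partially defined for t < 0, since a backward orbit may leave  *)
(* M through the boundary; whence the condition in flow_open.  The fields     *)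
(* flow_group, flow_forward and flow_generator force D to be the maximal      *)
(* domain.  The fields flow_forward, flow_open and flow_C1_* are part of the  *)
(* existence theorem for the flow of a C^1 vector field, inwardly transverse  *)
(* to the boundary, on a compact manifold.                                    *)
Record is_flow (X : M -> 'rV[R]_n) (D : R -> set M) (phi : R -> M -> M)
    : Prop := IsFlow {
  flow_zero : forall x, D 0 x /\ phi 0 x = x ;
  flow_interval : forall x, is_interval [set t | D t x] ;
  flow_group : forall s t x, D s x -> (D t (phi s x) <-> D (t + s) x) ;
  flow_add : forall s t x, D s x -> D (t + s) x ->
    phi (t + s) x = phi t (phi s x) ;
  flow_forward : forall t x, 0 <= t -> D t x ;
  flow_open : forall t x, D t x -> ~ boundary (phi t x) ->
    nbhs (t, x) [set p : R * M | D p.1 p.2] ;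
  flow_continuous :
    {within [set p : R * M | D p.1 p.2], continuous (fun p => phi p.1 p.2)} ;
  flow_generator : forall t x, D t x ->
    is_deriv_within ([set s | D s x] : set R^o)
      (fun s => chart (pref A (phi t x)) (phi s x)) t
      (fun h : R^o => h *: X (phi t x)) ;
  flow_C1_deriv : forall i j t x,
    chart_dom i x -> D t x -> chart_dom j (phi t x) ->
    is_jacobian (local_dom (D t) (phi t) i j)
      (chart j \o phi t \o chart_inv i) (chart i x)
      (tangent_map (D t) (phi t) i j x) ;
  flow_C1_continuous : forall i j,
    {within [set p : R * M |
               [/\ chart_dom i p.2, D p.1 p.2 & chart_dom j (phi p.1 p.2)]],
     continuous (fun p => tangent_map (D p.1) (phi p.1) i j p.2)}
}.

(* A subbundle of TM over Lam: V x is a matrix whose row space is a subspace  *)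
(* of T_x M.  Continuity means that V has continuous local frames.            *)
Definition continuous_subbundle (Lam : set M) (V : M -> 'M[R]_n) : Prop :=
  forall x, Lam x -> exists (k : nat) (U : set M) (B : M -> 'M[R]_(k, n)),
    [/\ open U, U x, U `<=` chart_dom (pref A x),
        {within Lam `&` U, continuous B} &
        forall y, Lam y -> U y -> row_free (B y) /\
          (B y :=: V y *m transition (pref A y) (pref A x) y)%MS].

Definition metric_norm (G : 'M[R]_n) (v : 'rV[R]_n) : R :=
  Num.sqrt ((v *m G *m v^T) ord0 ord0).

(* Norm of the restriction to the row space of V of the linear map of matrix  *)
(* J, between the Euclidean spaces with Gram matrices G and G'.               *)
Definition opnorm (G G' J V : 'M[R]_n) : R :=
  sup [set metric_norm G' (v *m J) |
        v in [set v : 'rV[R]_n | (v <= V)%MS /\ metric_norm G v <= 1]].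

(* Absolute value of the determinant of the restriction of J to the row space *)
(* of L, as a map onto its image: the ratio of the volumes of the             *)
(* parallelepipeds spanned by the image of a basis of L and by this basis.    *)
Definition absdet (G G' J L : 'M[R]_n) : R :=
  let B := row_base L in
  Num.sqrt (\det ((B *m J) *m G' *m (B *m J)^T) / \det (B *m G *m B^T)).

Section Dynamics.
Variables (g : M -> 'M[R]_n) (X : M -> 'rV[R]_n).
Variables (D : R -> set M) (phi : R -> M -> M).
Implicit Types (Lam : set M) (E F V : M -> 'M[R]_n).

(* DX_t(x) : T_x M -> T_(X_t(x)) M *)
Definition flow_deriv (t : R) (x : M) : 'M[R]_n :=
  tangent_map (D t) (phi t) (pref A x) (pref A (phi t x)) x.

(* || DX_t restricted to V_x || *)
Definition flow_norm (t : R) (x : M) V : R :=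
  opnorm (g x) (g (phi t x)) (flow_deriv t x) (V x).

Definition invariant_set Lam : Prop :=
  forall t, Lam `<=` D t /\ phi t @` Lam = Lam.

Definition invariant_subbundle Lam V : Prop :=
  forall t x, Lam x -> (V x *m flow_deriv t x :=: V (phi t x))%MS.

Definition invariant_splitting Lam E F : Prop :=
  [/\ forall x, Lam x ->
        (E x + F x :=: 1%:M)%MS /\ (E x :&: F x = 0 :> 'M[R]_n)%MS,
      forall x, Lam x -> E x != 0 /\ F x != 0,
      continuous_subbundle Lam E /\ continuous_subbundle Lam F &
      invariant_subbundle Lam E /\ invariant_subbundle Lam F].

Definition uniformly_contracted Lam E : Prop :=
  exists C lambda : R, [/\ 0 < C, 0 < lambda &
    forall x t, Lam x -> 0 <= t -> flow_norm t x E <= C * expR (- lambda * t)].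

Definition sectionally_expanding Lam F : Prop :=
  (exists2 d : nat, (2 <= d)%N & forall x, Lam x -> \rank (F x) = d) /\
  exists C lambda : R, [/\ 0 < C, 0 < lambda &
    forall x (L : 'M[R]_n), Lam x -> (L <= F x)%MS -> \rank L = 2%N ->
    forall t, 0 < t ->
      C * expR (lambda * t) < absdet (g x) (g (phi t x)) (flow_deriv t x) L].

Definition dominated_at_singularities Lam E F : Prop :=
  exists C lambda : R, [/\ 0 < C, 0 < lambda &
    forall s t, Lam s -> singularity X s -> 0 <= t ->
      flow_norm t s E * flow_norm (- t) s F < C * expR (- lambda * t)].

Definition dominated_splitting Lam E F : Prop :=
  invariant_splitting Lam E F /\
  exists K lambda : R, [/\ 0 < K, 0 < lambda &
    forall x t, Lam x -> 0 < t ->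
      flow_norm t x E * flow_norm (- t) (phi t x) F < K * expR (- lambda * t)].

End Dynamics.
End Manifold.

(* Main.v *)
Require Import Defs.
From HB Require Import structures.
From mathcomp Require Import all_boot all_order all_algebra.
From mathcomp Require Import complex.
From mathcomp Require Import all_classical all_reals all_analysis.
From mathcomp Require Import ring lra.
Set Implicit Arguments.
Unset Strict Implicit.
Unset Printing Implicit Defensive.
Import Order.TTheory GRing.Theory Num.Theory.
Import numFieldNormedType.Exports.
Local Open Scope classical_set_scope.
Local Open Scope ring_scope.

(* By compactness of the unit vectors of E and F, domination follows as soon as
   every pair of nonzero vectors u in E_x, w in F_x has a time k > 0 at which
   |DX_k u| |w| < |u| |DX_k w| / 2.  Suppose that (x, u, w) has no such time.
   Then |DX_k w| decays exponentially, because |DX_k u| does.  The vector X(x)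
   lies in F_x: a component along E would come from exponentially large vectors
   in the past, where X is bounded.  If w and X(x) were independent, the area of
   the parallelogram that they span would be at most |DX_k w| sup |X| and hence
   tend to 0, against sectional expansion.  So X(x) = 0 or w is a multiple of
   X(x); in the latter case X(X_k(x)) tends to 0.  In both cases the orbit is
   eventually close to the singularities, where the domination assumed at the
   singularities persists and forces a time k after all. *)

(** The negation compares every time k with time 0 only: the ratio |DX_k u| |w| / (|u| |DX_k w|)
    stays at least 1/2. It says nothing about the pair transported to a later time, so one halving
    near the singularities is not yet a contradiction. The domination there is iterated along the
    slow tail of the orbit, where each step of fixed length T halves the ratio, until the gain beats
    the constant accumulated before the tail begins. Closeness to the singularities is measured by
    the size of X, so that no distance on M enters. The tangent space at x is read in the chart
    [pref x], which may jump with x: as matrix functions, the metric, X, the derivative of the flow,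
    E and F need not be continuous. Limits at x are therefore taken with vectors expressed in the
    chart of x and carried to nearby points by [transition]. The compactness of the unit vectors is
    likewise replaced by two nested compactness arguments: coordinate spheres over local frames of E
    and F, then Lambda itself. The statements so obtained must be homogeneous in each vector; this,
    and the wish to avoid square roots, is why they compare products of squared norms. *)

(** * Entrywise limits and norm bounds for matrices *)

Section MatrixTopology.
Variables (R : realType).

Lemma cvg_mx (T : Type) (F : set_system T) {FF : Filter F} m n
    (f : T -> 'M[R]_(m, n)) (A : 'M[R]_(m, n)) :
  (forall i j, f x i j @[x --> F] --> A i j) -> f @ F --> A.
Proof.
move=> fA S [P AP PS].
have : \forall x \near F, forall i j, P i j (f x i j).
  apply: filter_forall => i; apply: filter_forall => j.
  exact: fA (AP i j).
by apply: filterS => x Px; exact: PS.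
Qed.

Lemma cvg_mx_entry (T : Type) (F : set_system T) {FF : Filter F} m n
    (f : T -> 'M[R]_(m, n)) (A : 'M[R]_(m, n)) i j :
  f @ F --> A -> f x i j @[x --> F] --> A i j.
Proof. by move=> fA; exact: (cvg_comp _ _ fA (@coord_continuous _ _ _ i j A)). Qed.

Lemma cvg_mulmx (T : Type) (F : set_system T) {FF : Filter F} m n p
    (f : T -> 'M[R]_(m, n)) (h : T -> 'M[R]_(n, p)) (A : 'M[R]_(m, n)) (B : 'M[R]_(n, p)) :
  f @ F --> A -> h @ F --> B -> f x *m h x @[x --> F] --> A *m B.
Proof.
move=> fA hB; apply: cvg_mx => i j; rewrite mxE.
under eq_cvg do rewrite mxE.
apply: cvg_big => [|k _]; first exact: add_continuous.
by apply: cvgM; exact: cvg_mx_entry.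
Qed.

Lemma cvg_trmx (T : Type) (F : set_system T) {FF : Filter F} m n
    (f : T -> 'M[R]_(m, n)) (A : 'M[R]_(m, n)) :
  f @ F --> A -> (f x)^T @[x --> F] --> A^T.
Proof.
move=> fA; apply: cvg_mx => i j; rewrite mxE.
by under eq_cvg do rewrite mxE; exact: cvg_mx_entry.
Qed.

Lemma mx_entry_le_norm m n (A : 'M[R]_(m, n)) i j : `|A i j| <= `|A|.
Proof.
rewrite [leRHS]/Num.norm /= mx_normrE; apply/bigmax_geP; right => /=.
by exists (i, j).
Qed.

Lemma mx_norm_le m n (A : 'M[R]_(m, n)) (c : R) :
  0 <= c -> (forall i j, `|A i j| <= c) -> `|A| <= c.
Proof.
move=> c0 Ac; rewrite [leLHS]/Num.norm /= mx_normrE.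
by apply/bigmax_leP; split => // -[i j] _; exact: Ac.
Qed.

Lemma mulmx_bound p q (J : 'M[R]_(p, q)) :
  exists2 C : R, 0 <= C & forall v : 'rV[R]_p, `|v *m J| <= C * `|v|.
Proof.
exists (\sum_(k < p) `|J|) => [|v]; first by rewrite sumr_ge0.
apply: mx_norm_le => [|i j]; first by rewrite mulr_ge0 ?sumr_ge0.
rewrite mxE (le_trans (ler_norm_sum _ _ _))// mulr_suml ler_sum// => k _.
by rewrite normrM mulrC ler_pM ?mx_entry_le_norm.
Qed.

End MatrixTopology.

(** * Derivatives relative to a set: chain rule and uniqueness *)

Section DerivWithin.
Variable R : realType.

Lemma near_normB_le (U : normedModType R) (a : U) (e : R) :
  0 < e -> \forall y \near nbhs a, `|y - a| <= e.
Proof.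
move=> e0; apply/nbhs_ballP; exists e => // y.
by rewrite -ball_normE /= distrC => /ltW.
Qed.

Lemma deriv_within_cvg (U V : normedModType R) (S : set U) (f : U -> V) a L C :
  (forall h, `|L h| <= C * `|h|) -> is_deriv_within S f a L ->
  f @ within S (nbhs a) --> f a.
Proof.
move=> LC fL.
have C0 : 0 < `|C| + 1 by rewrite ltr_wpDl.
apply/cvgrPdist_le => e e0; near=> y.
rewrite distrC -[f y - f a](subrK (L (y - a))) (le_trans (ler_normD _ _))//.
have -> : e = e / 2 + e / 2 by rewrite -splitr.
have ya : `|y - a| <= e / 2 / (`|C| + 1).
  by near: y; apply: cvg_within; apply: near_normB_le; rewrite !divr_gt0.
have ya1 : `|y - a| <= e / 2.
  by rewrite (le_trans ya)// ler_pdivrMr// ler_peMr ?lerDr// divr_ge0 ?ltW.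
apply: lerD.
  rewrite (le_trans _ ya1)// -[leRHS]mul1r; near: y.
  exact: (fL 1 ltr01).
rewrite (le_trans (LC _))// (@le_trans _ _ ((`|C| + 1) * `|y - a|))//.
  by rewrite ler_wpM2r// (le_trans (ler_norm C))// lerDl.
by rewrite mulrC -ler_pdivlMr.
Unshelve. all: by end_near. Qed.

(** Chain rule. [L] is a bare function, so its boundedness is assumed separately; [f] has to send
    [S] into [S'] only near [a], because chart domains are only locally preserved. *)
Lemma is_deriv_within_comp (U : normedModType R) p q (S : set U)
    (S' : set 'rV[R]_p) (f : U -> 'rV[R]_p) (h : 'rV[R]_p -> 'rV[R]_q)
    a L (J : 'M[R]_(p, q)) C :
  (forall v, `|L v| <= C * `|v|) -> is_deriv_within S f a L ->
  is_jacobian S' h (f a) J -> (\forall y \near within S (nbhs a), S' (f y)) ->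
  is_deriv_within S (h \o f) a (fun v => L v *m J).
Proof.
move=> LC fL hJ SS' e e0.
have fc := deriv_within_cvg LC fL.
have [CJ CJ0 JC] := mulmx_bound J.
have C0 : 0 < `|C| + 1 by rewrite ltr_wpDl.
have CJ1 : 0 < CJ + 1 by rewrite ltr_wpDl.
(* The bound 1 makes [f] Lipschitz at [a] with constant [|C| + 1]; the other bound leaves an error
   of at most e/2 after multiplication by [J]. *)
set e1 := Num.min 1 (e / 2 / (CJ + 1)).
have e1_gt0 : 0 < e1 by rewrite lt_min ltr01 /= !divr_gt0.
have e2_gt0 : 0 < e / 2 / (`|C| + 1) by rewrite !divr_gt0.
have hfy : \forall y \near within S (nbhs a),
    `|h (f y) - h (f a) - (f y - f a) *m J| <= e / 2 / (`|C| + 1) * `|f y - f a|.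
  by apply: filterS2 SS' (fc _ (hJ _ e2_gt0)) => y Sy; exact.
near=> y.
have d1 : `|f y - f a - L (y - a)| <= e1 * `|y - a|.
  by near: y; exact: fL.
have d2 : `|h (f y) - h (f a) - (f y - f a) *m J| <=
    e / 2 / (`|C| + 1) * `|f y - f a| by near: y.
have d3 : `|f y - f a| <= (`|C| + 1) * `|y - a|.
  rewrite -[f y - f a](subrK (L (y - a))) (le_trans (ler_normD _ _))//.
  rewrite addrC mulrDl lerD ?(le_trans (LC _))//.
    by rewrite ler_wpM2r// ler_norm.
  by rewrite (le_trans d1)// ler_wpM2r// ge_min lexx.
have -> : (h \o f) y - (h \o f) a - L (y - a) *m J =
    (h (f y) - h (f a) - (f y - f a) *m J) + (f y - f a - L (y - a)) *m J.
  by rewrite (mulmxBl (f y - f a) (L (y - a))) addrA subrK.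
rewrite (le_trans (ler_normD _ _))// [e in leRHS]splitr mulrDl lerD//.
  rewrite (le_trans d2)// -mulrA ler_pM2l ?divr_gt0//.
  by rewrite mulrC ler_pdivrMr// mulrC.
rewrite (le_trans (JC _))// (@le_trans _ _ (CJ * (e1 * `|y - a|)))//.
  by rewrite ler_wpM2l.
rewrite mulrA ler_wpM2r//.
rewrite (@le_trans _ _ ((CJ + 1) * e1))//; first by rewrite ler_wpM2r ?lerDl ?ltW.
by rewrite mulrC -ler_pdivlMr// ge_min lexx orbT.
Unshelve. all: by end_near. Qed.

(** Only the ray from [a] in the direction [v] is tested: both errors at [a + s *: v] are o(s), and
    homogeneity along [v] allows division by s. *)
Lemma deriv_within_uniq (U V : normedModType R) (S : set U) (f : U -> V) a
    (L L' : U -> V) v :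
  (forall s : R, L (s *: v) = s *: L v) ->
  (forall s : R, L' (s *: v) = s *: L' v) ->
  is_deriv_within S f a L -> is_deriv_within S f a L' ->
  (\forall s \near (0:R)^'+, S (a + s *: v)) -> L v = L' v.
Proof.
move=> Lv L'v fL fL' Sv.
apply/eqP; rewrite -subr_eq0 -normr_le0; apply/ler_addgt0Pr => e e0.
rewrite add0r.
have v0 : 0 < `|v| + 1 by rewrite ltr_wpDl.
have e2 : 0 < e / 2 / (`|v| + 1) by rewrite !divr_gt0.
have av : (a + s *: v) @[s --> (0:R)^'+] --> a.
  rewrite -[X in _ --> X]addr0 -(scale0r v).
  apply: cvgD; first exact: cvg_cst.
  by apply: cvgZr_tmp; exact: cvg_at_right_filter cvg_id.
have key L0 : is_deriv_within S f a L0 -> \forall s \near (0:R)^'+,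
    `|f (a + s *: v) - f a - L0 (s *: v)| <= e / 2 / (`|v| + 1) * `|s *: v|.
  move=> fL0; apply: filterS2 Sv (av _ (fL0 _ e2)) => s Ss /(_ Ss).
  by rewrite [a + _ - a]addrAC subrr add0r.
near (0:R)^'+ => s.
have s0 : 0 < s by [].
have d : `|f (a + s *: v) - f a - L (s *: v)| <= e / 2 / (`|v| + 1) * `|s *: v|.
  by near: s; exact: key.
have d' : `|f (a + s *: v) - f a - L' (s *: v)| <= e / 2 / (`|v| + 1) * `|s *: v|.
  by near: s; exact: key.
have : `|L (s *: v) - L' (s *: v)| <= e / (`|v| + 1) * `|s *: v|.
  have -> : L (s *: v) - L' (s *: v) =
    (f (a + s *: v) - f a - L' (s *: v)) - (f (a + s *: v) - f a - L (s *: v)).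
    by rewrite opprB [RHS]addrC addrA subrK.
  rewrite (le_trans (ler_normB _ _))//.
  have -> : e / (`|v| + 1) = e / 2 / (`|v| + 1) + e / 2 / (`|v| + 1).
    by rewrite -mulrDl -splitr.
  by rewrite mulrDl lerD.
rewrite Lv L'v -scalerBr !normrZ mulrCA ler_pM2l ?normr_gt0 ?gt_eqF// => /le_trans; apply.
by rewrite mulrAC ler_pdivrMr// ler_pM2l// lerDl.
Unshelve. all: by end_near. Qed.

(** At a boundary point only directions that stay in the half-space can be tested, but the standard
    basis vectors are among them and determine the matrix. *)
Lemma halfspace_jacobian_uniq n q (S : set 'rV[R]_n) (f : 'rV[R]_n -> 'rV[R]_q)
    a (J J' : 'M[R]_(n, q)) :
  halfspace a -> (\forall y \near within (@halfspace R n) (nbhs a), S y) ->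
  is_jacobian S f a J -> is_jacobian S f a J' -> J = J'.
Proof.
move=> Ha HS fJ fJ'.
have pos (v : 'rV[R]_n) : halfspace v -> v *m J = v *m J'.
  move=> Hv; apply: (deriv_within_uniq _ _ fJ fJ').
  - by move=> s; rewrite scalemxAl.
  - by move=> s; rewrite scalemxAl.
  have av : (a + s *: v) @[s --> (0:R)^'+] --> a.
    rewrite -[X in _ --> X]addr0 -(scale0r v).
    apply: cvgD; first exact: cvg_cst.
    by apply: cvgZr_tmp; exact: cvg_at_right_filter cvg_id.
  apply: filterS2 (nbhs_right_gt 0) (av _ HS) => s s0; apply => k k0.
  by rewrite !mxE addr_ge0 ?Ha// mulr_ge0 ?Hv ?ltW.
apply/row_matrixP => i; rewrite !rowE; apply: pos => k _.
by rewrite mxE; case: (_ && _).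
Qed.

End DerivWithin.

Lemma cvg_within_subset (T U : topologicalType) (A B : set T) (f : T -> U)
    (x : T) (l : U) :
  A `<=` B -> f @ within B (nbhs x) --> l -> f @ within A (nbhs x) --> l.
Proof.
move=> AB fB W lW.
have : \forall y \near x, B y -> W (f y) by exact: fB.
move=> h; suff : \forall y \near x, A y -> W (f y) by [].
by apply: filterS h => y h Ay; exact/h/AB.
Qed.

Lemma is_deriv_within_eq (R : realType) (U V : normedModType R) (S S' : set U)
    (f f' : U -> V) a (L L' : U -> V) :
  S' `<=` S -> (forall y, S' y -> f y = f' y) -> f a = f' a -> L =1 L' ->
  is_deriv_within S f a L -> is_deriv_within S' f' a L'.
Proof.
move=> SS' ff' fa LL' fL e e0; move: (fL e e0); rewrite !near_withinE; apply: filterS => y h S'y.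
by rewrite -ff'// -fa -LL' h//; exact: SS'.
Qed.

(** * The derivative cocycle of the flow in charts *)

Section Flow.
Variables (R : realType) (n : nat) (M : topologicalType).
Variable A : smooth_atlas R n M.
Variables (X : M -> 'rV[R]_n) (D : R -> set M) (phi : R -> M -> M).
Hypothesis hphi : is_flow A X D phi.
Implicit Types (i j k : chart_index A) (x y : M) (s t : R).

Local Notation tmap t := (@tangent_map R n M A (D t) (phi t)).
Local Notation J := (flow_deriv A D phi).

Lemma phi0 x : phi 0 x = x.
Proof. by have [] := flow_zero hphi x. Qed.

Lemma flow_dom_ge0 t x : 0 <= t -> D t x.
Proof. exact: (flow_forward hphi). Qed.

Lemma phiD s t x : 0 <= s -> 0 <= t + s -> phi (t + s) x = phi t (phi s x).
Proof. by move=> s0 ts0; apply: (flow_add hphi); exact: flow_dom_ge0. Qed.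

Lemma phiNK t x : 0 <= t -> phi (- t) (phi t x) = x.
Proof. by move=> t0; rewrite -phiD ?addNr ?phi0. Qed.

(** Changes of coordinates thus become the time-0 case of the tangent maps, and one cocycle identity
    serves for both. *)
Lemma transitionE i j x : transition i j x = tmap 0 i j x.
Proof.
have D0 : D 0 = setT by apply/seteqP; split => // y _; exact: flow_dom_ge0.
have p0 : phi 0 = id by apply/funext => y; rewrite phi0.
by rewrite D0 p0.
Qed.

Lemma phi_cvg t x : 0 <= t ->
  (fun p : R * M => phi p.1 p.2) @ within [set p | 0 <= p.1] (nbhs (t, x)) -->
  phi t x.
Proof.
move=> t0; have /subspace_continuousP/(_ (t, x)) := flow_continuous hphi.
move=> /(_ (flow_dom_ge0 _ t0)); apply: cvg_within_subset => p /=.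
exact: flow_dom_ge0.
Qed.

Lemma phi_continuous t : 0 <= t -> continuous (phi t).
Proof.
move=> t0 x W /(@phi_cvg t x t0).
have c : (t, y) @[y --> x] --> (t, x) by exact: (cvg_pair (cvg_cst t) cvg_id).
move=> /c h; have {h} : \forall y \near x, 0 <= t -> W (phi t y) by [].
move=> h; suff : \forall y \near x, W (phi t y) by [].
by apply: filterS h => y; exact.
Qed.

Lemma orbit_continuous x : (forall s, D s x) -> continuous (phi ^~ x).
Proof.
move=> Dx t W.
have /subspace_continuousP/(_ (t, x) (Dx t)) h := flow_continuous hphi.
have c : (s, x) @[s --> t] --> (t, x) by exact: (cvg_pair cvg_id (cvg_cst x)).
move=> /h /c {}h; have {h} : \forall s \near t, D s x -> W (phi s x) by [].
move=> h; suff : \forall s \near t, W (phi s x) by [].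
by apply: filterS h => s; exact.
Qed.

Lemma near_chart_dom i x : chart_dom i x -> \forall y \near x, chart_dom i y.
Proof. by move=> ix; apply: open_nbhs_nbhs; split => //; exact: chart_dom_open. Qed.

Lemma halfspace_chart i x : chart_dom i x -> halfspace (chart i x).
Proof.
move=> ix; have [W _ E] := chart_image_open i.
have : (chart i @` chart_dom i) (chart i x) by exists x.
by rewrite E => -[].
Qed.

(** Supplies the neighbourhood hypothesis of [halfspace_jacobian_uniq] when the domain of a map is
    cut down to a neighbourhood of x in M. *)
Lemma near_chart_image i x (W : set M) : chart_dom i x -> nbhs x W ->
  \forall b \near within (@halfspace R n) (nbhs (chart i x)),
    (chart i @` (chart_dom i `&` W)) b.
Proof.
move=> ix xW; have [V oV E] := chart_image_open i.
have xV : (chart i @` chart_dom i) (chart i x) by exists x.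
have ci : chart_inv i @ within (chart i @` chart_dom i) (nbhs (chart i x)) --> x.
  rewrite -[X in _ --> X](chartK ix).
  by have /subspace_continuousP := @chart_inv_continuous _ _ _ A i; apply.
have W' : \forall b \near chart i x,
  (chart i @` chart_dom i) b -> W (chart_inv i b) by exact: ci.
have : nbhs (chart i x) V.
  by apply: open_nbhs_nbhs; split => //; move: xV; rewrite E => -[].
rewrite near_withinE; apply: filterS2 W' => b b1 Vb Hb.
have : (V `&` @halfspace R n) b by [].
rewrite -E => bi; have := b1 bi.
by case: bi => y iy <-; rewrite chartK// => Wy; exists y.
Qed.

(** Both sides are derivatives of the same map at the same point of the half-space, the right one by
    the chain rule. The time [t] may be negative; [t = - s] will give the inverse of the
    derivative. *)
Lemma tangent_comp s t i j k x : 0 <= s -> 0 <= t + s ->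
  chart_dom i x -> chart_dom j (phi s x) -> chart_dom k (phi (t + s) x) ->
  tmap (t + s) i k x = tmap s i j x *m tmap t j k (phi s x).
Proof.
move=> s0 ts0 ix jx kx.
have Ds y : D s y by exact: flow_dom_ge0.
have Dts y : D (t + s) y by exact: flow_dom_ge0.
have Dt y : D t (phi s y) by exact/(flow_group hphi).
pose W : set M := phi s @^-1` chart_dom j `&` phi (t + s) @^-1` chart_dom k.
have xW : nbhs x W.
  apply: filterI; first exact: (phi_continuous s0 (near_chart_dom jx)).
  exact: (phi_continuous ts0 (near_chart_dom kx)).
apply: (halfspace_jacobian_uniq (f := chart k \o phi (t + s) \o chart_inv i)
  (halfspace_chart ix) (near_chart_image ix xW)).
  apply: is_deriv_within_eq (flow_C1_deriv hphi ix (Dts x) kx) => //.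
  by move=> _ [y [iy [jy ky]] <-]; exists y.
have kx' : chart_dom k (phi t (phi s x)) by rewrite -phiD.
have c : chart j (phi s x) = (chart j \o phi s \o chart_inv i) (chart i x).
  by rewrite /= chartK.
have h1 := flow_C1_deriv hphi ix (Ds x) jx.
have h2 := flow_C1_deriv hphi jx (Dt x) kx'.
have [C _ LC] := mulmx_bound (tmap s i j x).
rewrite c in h2.
have S1 : chart i @` (chart_dom i `&` W) `<=` local_dom (D s) (phi s) i j.
  by move=> _ [y [iy [jy ky]] <-]; exists y.
have h1' := is_deriv_within_eq S1 (fun _ _ => erefl) erefl (fun _ => erefl) h1.
apply: is_deriv_within_eq (is_deriv_within_comp LC h1' h2 _) => //.
- move=> _ [y [iy [jy ky]] <-].
  by rewrite /= !chartK// phiD.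
- by rewrite /= !chartK// phiD.
- by move=> v /=; rewrite mulmxA.
near=> b.
have : (chart i @` (chart_dom i `&` W)) b by near: b; exact: withinT.
case=> y [iy [jy ky]] <-; exists (phi s y); last by rewrite /= chartK.
by split; [split|rewrite /preimage /= -phiD].
Unshelve. all: by end_near. Qed.

Lemma tangent_id i x : chart_dom i x -> tmap 0 i i x = 1%:M.
Proof.
move=> ix; have ix0 : chart_dom i (phi 0 x) by rewrite phi0.
have h := flow_C1_deriv hphi ix (flow_dom_ge0 x (lexx 0)) ix0.
have S1 : chart i @` (chart_dom i `&` setT) `<=` local_dom (D 0) (phi 0) i i.
  move=> _ [y [iy _] <-]; exists y => //; split; last by rewrite /= phi0.
  by split => //; exact: flow_dom_ge0.
apply: (halfspace_jacobian_uniq (f := chart i \o phi 0 \o chart_inv i)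
  (halfspace_chart ix) (near_chart_image ix filterT)).
  exact: is_deriv_within_eq h.
move=> e e0; near=> b.
have : (chart i @` (chart_dom i `&` setT)) b by near: b; exact: withinT.
case=> y [iy _] <-; rewrite /= !chartK// !phi0 mulmx1 subrr normr0.
by rewrite mulr_ge0 // ltW.
Unshelve. all: by end_near. Qed.

Lemma flow_derivD s t x : 0 <= s -> 0 <= t + s ->
  J (t + s) x = J s x *m J t (phi s x).
Proof.
move=> s0 ts0; rewrite /flow_deriv phiD//; apply: tangent_comp => //.
- exact: pref_dom.
- exact: pref_dom.
- by rewrite phiD//; exact: pref_dom.
Qed.

Lemma flow_deriv0 x : J 0 x = 1%:M.
Proof. by rewrite /flow_deriv phi0 tangent_id//; exact: pref_dom. Qed.

Lemma flow_derivK t x : 0 <= t -> J t x *m J (- t) (phi t x) = 1%:M.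
Proof. by move=> t0; rewrite -flow_derivD ?addNr// flow_deriv0. Qed.

End Flow.

Lemma cvg_within_near (T U : topologicalType) (A B : set T) (f : T -> U)
    (x : T) (l : U) :
  (\forall y \near x, A y -> B y) ->
  f @ within B (nbhs x) --> l -> f @ within A (nbhs x) --> l.
Proof.
move=> AB fB W lW.
have h : \forall y \near x, B y -> W (f y) by exact: fB.
suff : \forall y \near x, A y -> W (f y) by [].
by apply: filterS2 AB h => y AB h Ay; exact/h/AB.
Qed.

Lemma cvg_into_within (T : Type) (U : topologicalType) (F : set_system T)
    {FF : Filter F} (f : T -> U) (l : U) (S : set U) :
  f @ F --> l -> (\forall x \near F, S (f x)) -> f @ F --> within S (nbhs l).
Proof.
move=> fl FS W lW.
have h : \forall x \near F, S (f x) -> W (f x) := fl _ lW.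
suff : \forall x \near F, W (f x) by [].
by apply: filterS2 FS h => x Sx; exact.
Qed.

Lemma is_deriv_withinT (R : realType) (U V : normedModType R) (S : set U)
    (f : U -> V) a (L : U -> V) :
  nbhs a S -> is_deriv_within S f a L -> is_deriv_within setT f a L.
Proof.
move=> aS fL e e0; move: (fL e e0); rewrite !near_withinE.
by apply: filterS2 aS => y Sy h _; exact: h.
Qed.

Lemma zero_deriv_cst (R : realType) (n : nat) (f : R -> 'rV[R]_n) (b : R) :
  0 <= b -> (forall r, 0 <= r <= b ->
    is_deriv_within setT (f : R^o -> 'rV[R]_n) r (fun=> 0)) -> f b = f 0.
Proof.
rewrite le_eqVlt => /predU1P[<-//|b0 fD].
apply/rowP => k; apply/eqP; rewrite -subr_eq0; apply/eqP.
have L0 : forall h : R^o, `|0 : 'rV[R]_n| <= 0 * `|h|.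
  by move=> h; rewrite normr0 mul0r.
have [||c _ ->] := @MVT R (fun r => f r ord0 k) (fun=> 0) 0 b b0.
- move=> r; rewrite in_itv/= => /andP[r0 rb].
  have {}fD : is_deriv_within setT (f : R^o -> 'rV[R]_n) r (fun=> 0).
    by apply: fD; rewrite !ltW.
  have h : h^-1 *: (f (h *: 1 + r) ord0 k - f r ord0 k) @[h --> (0:R)^'] --> (0 : R).
    apply/cvgrPdist_le => e e0.
    have c : (h *: 1 + r : R) @[h --> (0:R)] --> r.
      rewrite -[X in _ --> X]add0r -[X in X + _](@scale0r R R^o 1).
      by apply: cvgD; [exact: cvgZr_tmp|exact: cvg_cst].
    have {}c : \forall h \near (0:R), `|f (h *: 1 + r) - f r - 0| <= e * `|h *: 1 + r - r|.
      have := c _ (fD e e0) => c'.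
      have {}c' : \forall h \near (0:R), setT (h *: 1 + r : R) ->
        `|f (h *: 1 + r) - f r - 0| <= e * `|h *: 1 + r - r| by [].
      by apply: filterS c' => h; exact.
    rewrite near_withinE; apply: filterS c => h + h0.
    rewrite subr0 addrK sub0r normrN [h *: 1]mulr1 => H.
    rewrite normrZ normfV ler_pdivrMl ?normr_gt0// mulrC (le_trans _ H)//.
    by have := mx_entry_le_norm (f (h + r) - f r) ord0 k; rewrite !mxE.
  split; first by apply/cvg_ex; exists 0.
  by apply/cvg_lim.
- apply/subspace_continuousP => r; rewrite /= in_itv /= => rb.
  apply: cvg_within_filter.
  have := deriv_within_cvg L0 (fD r rb).
  by rewrite withinET => h; exact: (@cvg_mx_entry _ _ _ _ _ _ _ _ ord0 k h).
by rewrite mul0r.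
Qed.

Lemma gram_mulmx (R : comPzRingType) m n p (S : 'M[R]_(m, n)) (T : 'M[R]_(n, p))
    (B : 'M[R]_(m, p)) (G : 'M[R]_p) :
  B = S *m T -> S *m (T *m G *m T^T) *m S^T = B *m G *m B^T.
Proof. by move=> ->; rewrite trmx_mul !mulmxA. Qed.

(** * The vector field along orbits *)

Section Orbits.
Variables (R : realType) (n : nat) (M : topologicalType).
Variable A : smooth_atlas R n M.
Variables (X : M -> 'rV[R]_n) (D : R -> set M) (phi : R -> M -> M).
Hypothesis hphi : is_flow A X D phi.
Implicit Types (i j k : chart_index A) (x y : M) (s t : R).

Local Notation tmap t := (@tangent_map R n M A (D t) (phi t)).
Local Notation J := (flow_deriv A D phi).

Lemma orbit_deriv x r t j : (forall s, D s x) -> 0 <= t ->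
  chart_dom j (phi (t + r) x) ->
  is_deriv_within setT (fun s : R^o => chart j (phi (t + s) x)) r
    (fun h : R^o => h *: (X (phi r x) *m tmap t (pref A (phi r x)) j (phi r x))).
Proof.
move=> Dx t0 jx; set y := phi r x; set i := pref A y.
have iy : chart_dom i y by exact: pref_dom.
have phitr s : phi (t + s) x = phi t (phi s x) by exact: (flow_add hphi).
have jy : chart_dom j (phi t y) by rewrite -phitr.
pose S : set R := [set s | chart_dom i (phi s x)].
have rS : nbhs r S.
  exact: (orbit_continuous hphi Dx) (near_chart_dom iy).
apply: (is_deriv_withinT rS).
have h1 := flow_generator hphi (Dx r).
have h2 := flow_C1_deriv hphi iy (flow_dom_ge0 hphi y t0) jy.
have LC : forall h : R^o, `|h *: X y| <= `|X y| * `|h|.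
  by move=> h; rewrite normrZ mulrC.
apply: is_deriv_within_eq (is_deriv_within_comp LC h1 h2 _) => //=.
- by move=> s _; exact: Dx.
- by move=> s Ss; rewrite chartK// phitr.
- by rewrite chartK// phitr.
- by move=> h; rewrite -scalemxAl.
rewrite near_withinE.
have := orbit_continuous hphi Dx (phi_continuous hphi t0 (near_chart_dom jy)).
move=> jS; have {}jS : \forall s \near r, chart_dom j (phi t (phi s x)) by [].
apply: filterS2 rS jS => s Ss js _; exists (phi s x) => //.
by do 2!split => //; exact: (flow_dom_ge0 hphi).
Qed.

(** Differentiate X_(t+s)(x) at s = 0 in two ways: as X_t applied to X_s(x), and directly through
    the generator at time t. *)
Lemma vf_flow x t : (forall s, D s x) -> 0 <= t -> X x *m J t x = X (phi t x).
Proof.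
move=> Dx t0; rewrite /flow_deriv; set j := pref A (phi t x).
have jx : chart_dom j (phi (t + 0) x) by rewrite addr0; exact: pref_dom.
have h1 := orbit_deriv Dx t0 jx; rewrite (phi0 hphi) in h1.
have h2 : is_deriv_within setT (fun s : R^o => chart j (phi (t + s) x)) 0
    (fun h : R^o => h *: X (phi t x)).
  move=> e e0.
  have := flow_generator hphi (Dx t) e0; rewrite !near_withinE => h2.
  have c : (t + s : R) @[s --> (0:R)] --> t.
    by rewrite -[X in _ --> X]addr0; apply: cvgD; [exact: cvg_cst|].
  have {c} := c _ h2 => {}h2.
  have {}h2 : \forall s \near (0:R), D (t + s) x ->
    `|chart j (phi (t + s) x) - chart j (phi t x) - (t + s - t) *: X (phi t x)|
    <= e * `|t + s - t| by [].
  apply: filterS h2 => s /(_ (Dx _)) + _.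
  by rewrite addr0 subr0 [t + s - t]addrAC subrr add0r.
have := deriv_within_uniq (v := 1 : R^o) _ _ h1 h2.
rewrite !scale1r; apply => //.
- by move=> s; rewrite [s *: 1]mulr1.
- by move=> s; rewrite [s *: 1]mulr1.
by near=> s.
Unshelve. all: by end_near. Qed.

(** By [vf_flow] and linearity X vanishes on the whole forward orbit. While the orbit stays in one
    chart its coordinates are therefore constant; the group law extends this from short times to all
    t. *)
Lemma singularity_fixed x t : (forall s, D s x) -> singularity X x -> 0 <= t ->
  phi t x = x.
Proof.
move=> Dx Xx t0; set j := pref A x.
have jx : chart_dom j x by exact: pref_dom.
have X0 r : 0 <= r -> X (phi r x) = 0 by move=> r0; rewrite -vf_flow// Xx mul0mx.
have : nbhs (0:R) [set s | chart_dom j (phi s x)].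
  by apply: (orbit_continuous hphi Dx); rewrite (phi0 hphi); exact: near_chart_dom.
move=> /nbhs_ballP[d /= d0 dj].
have {}dj r : 0 <= r < d -> chart_dom j (phi r x).
  by move=> /andP[r0 rd]; apply: dj; rewrite -ball_normE/= sub0r normrN ger0_norm.
have fix_small r : 0 <= r < d -> phi r x = x.
  move=> /andP[r0 rd].
  have /zero_deriv_cst-/(_ r0) : forall s, 0 <= s <= r ->
      is_deriv_within setT (fun s : R^o => chart j (phi s x)) s (fun=> 0).
    move=> s /andP[s0 sr].
    have js : chart_dom j (phi (0 + s) x).
      by rewrite add0r; apply: dj; rewrite s0 (le_lt_trans sr).
    apply: is_deriv_within_eq (orbit_deriv Dx (lexx 0) js) => //.
    - by move=> s' _; rewrite add0r.
    - by rewrite add0r.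
    - by move=> h; rewrite X0// mul0mx scaler0.
  rewrite (phi0 hphi) => jj.
  have jr : chart_dom j (phi r x) by apply: dj; rewrite r0.
  by rewrite -(chartK jr) jj chartK.
have iter_fix r m : 0 <= r < d -> phi (m%:R * r) x = x.
  move=> rd; elim: m => [|m IH]; first by rewrite mul0r (phi0 hphi).
  by rewrite -natr1 mulrDl mul1r addrC (flow_add hphi)// IH fix_small.
(* The time t is cut into m equal pieces, each shorter than d. *)
have [m tm] : exists m : nat, t / d < m%:R.
  by exists (Num.bound (t / d)); apply: archi_boundP; rewrite divr_ge0// ltW.
have m0 : 0 < m%:R :> R by rewrite (le_lt_trans _ tm)// divr_ge0// ltW.
rewrite -[t](divfK (lt0r_neq0 m0)) mulrC iter_fix//.
rewrite divr_ge0 ?(ltW m0)//=.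
by rewrite ltr_pdivrMr// mulrC -ltr_pdivrMr.
Qed.

End Orbits.

(** * Continuity of the transported metric and of the size of X *)

Section Continuity.
Variables (R : realType) (n : nat) (M : topologicalType).
Variable A : smooth_atlas R n M.
Variables (g : M -> 'M[R]_n) (X : M -> 'rV[R]_n).
Variables (D : R -> set M) (phi : R -> M -> M).
Hypothesis hphi : is_flow A X D phi.
Hypothesis hg : riemannian_metric A g.
Implicit Types (i j k : chart_index A) (x y : M) (s t : R).

Local Notation tmap t := (@tangent_map R n M A (D t) (phi t)).
Local Notation J := (flow_deriv A D phi).

Lemma transitionK i j x : chart_dom i x -> chart_dom j x ->
  transition i j x *m transition j i x = 1%:M.
Proof.
move=> ix jx; rewrite !(transitionE hphi) -[X in _ *m tmap 0 _ _ X](phi0 hphi).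
rewrite -(tangent_comp hphi) ?addr0 ?(phi0 hphi)//.
exact: (tangent_id hphi).
Qed.

(** The Gram matrix at y of the pullback of the metric under X_t, in the coordinates of the chart of
    x0 instead of that of y. *)
Definition pullback_metric x0 t y : 'M[R]_n :=
  let B := transition (pref A x0) (pref A y) y *m J t y in
  B *m g (phi t y) *m B^T.

Lemma chart_cvg (T : Type) (F : set_system T) {FF : Filter F} (f : T -> M) j x :
  chart_dom j x -> f @ F --> x ->
  chart j (f y) @[y --> F] --> within (chart_image j) (nbhs (chart j x)).
Proof.
move=> jx fx.
have jf : \forall y \near F, chart_dom j (f y).
  by have := fx _ (near_chart_dom jx).
apply: cvg_into_within.
  have /subspace_continuousP := @chart_continuous _ _ _ A j.
  by move=> /(_ x jx); apply: cvg_comp; exact: cvg_into_within.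
by apply: filterS jf => y jy; exists (f y).
Qed.

Lemma metric_rep_cvg (T : Type) (F : set_system T) {FF : Filter F} (f : T -> M) j x :
  chart_dom j x -> f @ F --> x ->
  metric_rep g j (chart j (f y)) @[y --> F] --> metric_rep g j (chart j x).
Proof.
move=> jx fx; have [_ _ /(_ j 0%N)/= /subspace_continuousP] := hg.
have jx' : chart_image j (chart j x) by exists x.
by move=> /(_ _ jx'); apply: cvg_comp; exact: chart_cvg.
Qed.

(** The possibly jumping charts [pref A y] and [pref A (phi t y)] cancel: by the cocycle identity
    the matrix can be rewritten with the two charts of the limit point and its image, in which all
    the ingredients are continuous. *)
Lemma pullback_metric_cvg x0 t0 : 0 <= t0 ->
  (fun p : R * M => pullback_metric x0 p.1 p.2) @
    within [set p | 0 <= p.1] (nbhs (t0, x0)) --> pullback_metric x0 t0 x0.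
Proof.
move=> t00; set i := pref A x0; set j := pref A (phi t0 x0).
have ix : chart_dom i x0 by exact: pref_dom.
have jx : chart_dom j (phi t0 x0) by exact: pref_dom.
have pE t y : 0 <= t -> chart_dom i y -> chart_dom j (phi t y) ->
    tmap t i j y *m metric_rep g j (chart j (phi t y)) *m (tmap t i j y)^T =
    pullback_metric x0 t y.
  move=> t1 iy jy; rewrite /pullback_metric /metric_rep /= chartK//.
  set x := phi t y.
  have iy' : chart_dom i (phi 0 y) by rewrite (phi0 hphi).
  have t0' : 0 <= t + 0 by rewrite addr0.
  have t0'' : 0 <= 0 + t by rewrite add0r.
  have yy : chart_dom (pref A y) (phi 0 y) by rewrite (phi0 hphi); exact: pref_dom.
  have xx : chart_dom (pref A x) (phi (t + 0) y) by rewrite addr0; exact: pref_dom.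
  have xx' : chart_dom (pref A x) (phi (0 + t) y) by rewrite add0r; exact: pref_dom.
  have e1 := tangent_comp hphi (lexx 0) t0' iy yy xx.
  have e2 := tangent_comp hphi t1 t0'' iy jy xx'.
  rewrite addr0 (phi0 hphi) in e1; rewrite add0r in e2.
  apply: gram_mulmx; rewrite !(transitionE hphi).
  exact: etrans (esym e1) e2.
rewrite -pE//.
have phic : (fun p : R * M => phi p.1 p.2) @
    within [set p | 0 <= p.1] (nbhs (t0, x0)) --> phi t0 x0 by exact: (phi_cvg hphi).
have iN : \forall p \near (t0, x0), chart_dom i p.2.
  exact: (@cvg_snd _ _ (nbhs t0) (nbhs x0) _ _ (near_chart_dom ix)).
have jN : \forall p \near (t0, x0), 0 <= p.1 -> chart_dom j (phi p.1 p.2).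
  exact: phic (near_chart_dom jx).
apply: (@cvg_trans _ ((fun p : R * M => tmap p.1 i j p.2 *m
    metric_rep g j (chart j (phi p.1 p.2)) *m (tmap p.1 i j p.2)^T) @
    within [set p | 0 <= p.1] (nbhs (t0, x0)))).
  apply: near_eq_cvg; rewrite near_withinE.
  by apply: filterS2 iN jN => p ip /[swap] p0 /(_ p0) jp; rewrite pE.
have Tc : tmap p.1 i j p.2 @[p --> within [set p | 0 <= p.1] (nbhs (t0, x0))]
    --> tmap t0 i j x0.
  have /subspace_continuousP/(_ (t0, x0)) := flow_C1_continuous hphi (i := i) (j := j).
  have H : [/\ chart_dom i (t0, x0).2, D (t0, x0).1 (t0, x0).2
      & chart_dom j (phi (t0, x0).1 (t0, x0).2)].
    by split => //; exact: (flow_dom_ge0 hphi).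
  move=> /(_ H); apply: cvg_within_near.
  apply: filterS2 iN jN => p ip /[swap] p0 /(_ p0) jp.
  by split => //; exact: (flow_dom_ge0 hphi).
by apply: cvg_mulmx; [apply: cvg_mulmx => //; exact: metric_rep_cvg|exact: cvg_trmx].
Qed.

Lemma vf_norm_cvg x : C1_vector_field A X ->
  X y *m g y *m (X y)^T @[y --> x] --> X x *m g x *m (X x)^T.
Proof.
move=> hX; set i := pref A x.
have ix : chart_dom i x by exact: pref_dom.
have pE y : chart_dom i y -> vf_rep X i (chart i y) *m
    metric_rep g i (chart i y) *m (vf_rep X i (chart i y))^T =
    X y *m g y *m (X y)^T.
  move=> iy; rewrite /vf_rep /metric_rep /= chartK//.
  have K : transition (pref A y) i y *m transition i (pref A y) y = 1%:M.
    by apply: transitionK => //; exact: pref_dom.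
  rewrite -[in RHS](mulmx1 (X y)) -K.
  by apply: gram_mulmx; rewrite mulmxA.
rewrite -pE//.
apply: (@cvg_trans _ ((fun y => vf_rep X i (chart i y) *m
    metric_rep g i (chart i y) *m (vf_rep X i (chart i y))^T) @ x)).
  by apply: near_eq_cvg; apply: filterS (near_chart_dom ix) => y; exact: pE.
have Xc : vf_rep X i (chart i y) @[y --> x] --> vf_rep X i (chart i x).
  have [df [hd _]] := hX i.
  have ix' : chart_image i (chart i x) by exists x.
  have LC : forall h : 'rV[R]_n, `|\sum_(k < n) h ord0 k *: df k (chart i x)| <=
      (\sum_(k < n) `|df k (chart i x)|) * `|h|.
    move=> h; rewrite (le_trans (ler_norm_sum _ _ _))// mulr_suml ler_sum// => k _.
    by rewrite normrZ mulrC ler_wpM2l// mx_entry_le_norm.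
  apply: cvg_comp (deriv_within_cvg LC (hd _ ix')).
  exact: chart_cvg.
by apply: cvg_mulmx; [apply: cvg_mulmx => //; exact: metric_rep_cvg|exact: cvg_trmx].
Qed.

End Continuity.

(** * Inner products, operator norms and two-dimensional determinants *)

Section Forms.
Variable R : realType.

Definition gdot n (G : 'M[R]_n) (u v : 'rV[R]_n) : R := (u *m G *m v^T) ord0 ord0.

Definition posdef n (G : 'M[R]_n) : Prop :=
  G^T = G /\ forall v : 'rV[R]_n, v != 0 -> 0 < gdot G v v.

Lemma gdotDl n (G : 'M[R]_n) u u' v : gdot G (u + u') v = gdot G u v + gdot G u' v.
Proof. by rewrite /gdot !mulmxDl mxE. Qed.

Lemma gdotDr n (G : 'M[R]_n) u v v' : gdot G u (v + v') = gdot G u v + gdot G u v'.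
Proof. by rewrite /gdot linearD mulmxDr mxE. Qed.

Lemma gdotZl n (G : 'M[R]_n) a u v : gdot G (a *: u) v = a * gdot G u v.
Proof. by rewrite /gdot -!scalemxAl mxE. Qed.

Lemma gdotZr n (G : 'M[R]_n) a u v : gdot G u (a *: v) = a * gdot G u v.
Proof. by rewrite /gdot linearZ -scalemxAr mxE. Qed.

Lemma gdotC n (G : 'M[R]_n) u v : posdef G -> gdot G u v = gdot G v u.
Proof.
move=> [GT _]; rewrite /gdot -[in LHS](trmxK (u *m G *m v^T)) mxE.
by rewrite !trmx_mul trmxK GT mulmxA.
Qed.

Lemma gdot_ge0 n (G : 'M[R]_n) v : posdef G -> 0 <= gdot G v v.
Proof.
move=> [_ G0]; have [->|/G0/ltW//] := eqVneq v 0.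
by rewrite /gdot !mul0mx mxE.
Qed.

Lemma gdot_gt0 n (G : 'M[R]_n) v : posdef G -> v != 0 -> 0 < gdot G v v.
Proof. by move=> [_ G0] /G0. Qed.

(** Positivity of the squared length of <v,v> u - <u,v> v, which is nonzero because u is not a
    multiple of v. *)
Lemma cauchy_schwarz_strict n (G : 'M[R]_n) u v : posdef G ->
  v != 0 -> ~~ (u <= v)%MS -> gdot G u v ^+ 2 < gdot G u u * gdot G v v.
Proof.
move=> pG v0 uv.
have vv : 0 < gdot G v v by exact: gdot_gt0.
have nz : gdot G v v *: u + - gdot G u v *: v != 0.
  apply: contra uv; rewrite scaleNr subr_eq0 => /eqP E.
  apply/sub_rVP; exists ((gdot G v v)^-1 * gdot G u v).
  by rewrite -scalerA -E scalerA mulVf ?scale1r// gt_eqF.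
have := gdot_gt0 pG nz.
rewrite !(gdotDl, gdotDr, gdotZl, gdotZr) (gdotC v u pG).
set a := gdot G u u; set b := gdot G u v; set c := gdot G v v.
have -> : c * (c * a + - b * b) + (c * (- b * b) + - b * (- b * c)) =
  c * (a * c - b ^+ 2) by ring.
by rewrite pmulr_rgt0// subr_gt0.
Qed.

Lemma metric_normE n (G : 'M[R]_n) v : metric_norm G v = Num.sqrt (gdot G v v).
Proof. by []. Qed.

Lemma metric_norm_sqr n (G : 'M[R]_n) v : posdef G ->
  metric_norm G v ^+ 2 = gdot G v v.
Proof. by move=> pG; rewrite sqr_sqrtr// gdot_ge0. Qed.

Lemma metric_normZ n (G : 'M[R]_n) a v :
  metric_norm G (a *: v) = `|a| * metric_norm G v.
Proof.
rewrite !metric_normE gdotZl gdotZr mulrA -expr2 sqrtrM ?sqr_ge0//.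
by rewrite sqrtr_sqr.
Qed.

Lemma metric_norm_gt0 n (G : 'M[R]_n) v : posdef G -> v != 0 -> 0 < metric_norm G v.
Proof. by move=> pG v0; rewrite sqrtr_gt0; exact: gdot_gt0. Qed.

Lemma gdot_cvg (T : Type) (F : set_system T) {FF : Filter F} n
    (G : T -> 'M[R]_n) (u v : T -> 'rV[R]_n) (G0 : 'M[R]_n) (u0 v0 : 'rV[R]_n) :
  G @ F --> G0 -> u @ F --> u0 -> v @ F --> v0 ->
  gdot (G x) (u x) (v x) @[x --> F] --> gdot G0 u0 v0.
Proof.
move=> GF uF vF; apply: cvg_mx_entry.
by apply: cvg_mulmx; [exact: cvg_mulmx|exact: cvg_trmx].
Qed.

Lemma sphere_compact n : compact [set v : 'rV[R]_n | `|v| = 1].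
Proof.
apply: bounded_closed_compact.
  by exists 1; split => // x x1 v /= ->; exact: ltW.
have -> : [set v : 'rV[R]_n | `|v| = 1] = (fun v : 'rV[R]_n => `|v|) @^-1` [set 1].
  by [].
by apply: closed_comp => [v _|]; [exact: norm_continuous|exact: closed_eq].
Qed.

Lemma cvg_lt_near (T : Type) (F : set_system T) {FF : Filter F} (f h : T -> R) (a b : R) :
  f @ F --> a -> h @ F --> b -> a < b -> \forall x \near F, f x < h x.
Proof.
move=> fa hb ab.
have d0 : 0 < b - a by rewrite subr_gt0.
have d : h x - f x @[x --> F] --> b - a by exact: cvgB.
by apply: filterS (cvgr_gt _ d _ d0) => x; rewrite subr_gt0.
Qed.

Lemma cvg_le_mul_near (T : Type) (F : set_system T) {FF : Filter F} (f h : T -> R) (a b : R) :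
  f @ F --> a -> h @ F --> b -> 0 < b ->
  exists K0, \forall x \near F, forall K, K0 <= K -> f x <= K * h x.
Proof.
move=> fa hb b0; exists ((`|a| + 1) / (b / 2)).
have a1 : a < `|a| + 1 by rewrite (le_lt_trans (ler_norm a))// ltrDl.
have b2 : b / 2 < b by lra.
apply: filterS2 (cvg_lt_near fa (cvg_cst _) a1) (cvg_lt_near (cvg_cst _) hb b2).
move=> x fx hx K K0; have b20 : 0 < b / 2 by rewrite divr_gt0.
rewrite (le_trans (ltW fx))// (@le_trans _ _ (K * (b / 2)))//.
  by rewrite -ler_pdivrMr.
apply: ler_wpM2l; last exact: ltW.
by rewrite (le_trans _ K0)// divr_ge0 ?ltW// ltr_wpDl.
Qed.

Lemma sphere_near n (I : Type) (F : set_system I) {FF : Filter F}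
    (P : I -> 'rV[R]_n -> Prop) :
  (forall v, `|v| = 1 -> \forall v' \near v & i \near F, P i v') ->
  \forall i \near F, forall v, `|v| = 1 -> P i v.
Proof.
by move=> H; have /compact_near_coveringP := @sphere_compact n; apply.
Qed.

Lemma gdot_bound n (G G' J : 'M[R]_n) : posdef G ->
  exists2 K, 0 <= K & forall v, gdot G' (v *m J) (v *m J) <= K * gdot G v v.
Proof.
move=> pG.
have H : \forall K \near +oo, forall v : 'rV[R]_n, `|v| = 1 ->
    gdot G' (v *m J) (v *m J) <= K * gdot G v v.
  apply: sphere_near => v v1.
  have v0 : v != 0 by rewrite -normr_gt0 v1.
  have vJ : v' *m J @[v' --> v] --> v *m J.
    by exact: (cvg_mulmx (f := id) (@cvg_id _ (nbhs v)) (cvg_cst J)).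
  have fa : gdot G' (v' *m J) (v' *m J) @[v' --> v] --> gdot G' (v *m J) (v *m J).
    exact: (gdot_cvg (cvg_cst G') vJ vJ).
  have hb : gdot G v' v' @[v' --> v] --> gdot G v v.
    exact: (gdot_cvg (F := nbhs v) (u := id) (v := id) (cvg_cst G) cvg_id cvg_id).
  have [K0 HK0] := cvg_le_mul_near fa hb (gdot_gt0 pG v0).
  exists ([set v' | forall K, K0 <= K ->
    gdot G' (v' *m J) (v' *m J) <= K * gdot G v' v'], [set K | K0 <= K]) => /=.
    by split; [exact: HK0|apply: nbhs_pinfty_ge; exact: num_real].
  by move=> [v' K] [/= + /= K0K]; apply.
have [K [K0 {}H]] := filter_ex (filterI (nbhs_pinfty_ge (num_real 0)) H).
exists K => // v; have [->|v0] := eqVneq v 0.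
  by rewrite mul0mx /gdot !mul0mx mxE mulr0.
have nv : `|v| != 0 by rewrite normr_eq0.
have := H (`|v|^-1 *: v); rewrite normrZ normfV normr_id mulVf// => /(_ erefl).
rewrite -scalemxAl !(gdotZl, gdotZr) (mulrCA K) (mulrCA K) !ler_pM2l ?invr_gt0 ?normr_gt0//.
Qed.

(** Since [sup] is 0 on a set without supremum, this finiteness is what lets [opnorm] bound
    individual vectors. *)
Lemma metric_norm_bounded n (G G' J V : 'M[R]_n) : posdef G ->
  has_sup [set metric_norm G' (v *m J) |
           v in [set v : 'rV[R]_n | (v <= V)%MS /\ metric_norm G v <= 1]].
Proof.
move=> pG; split.
  exists (metric_norm G' (0 *m J)); exists 0 => //; split; first exact: sub0mx.
  by rewrite metric_normE /gdot !mul0mx mxE sqrtr0.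
have [K K0 HK] := gdot_bound G' J pG.
exists (Num.sqrt K) => _ [v [_ v1] <-].
rewrite ler_sqrt// (le_trans (HK v))//.
by rewrite -[leRHS]mulr1 ler_wpM2l// -metric_norm_sqr// expr_le1// sqrtr_ge0.
Qed.

Lemma le_opnorm n (G G' J V : 'M[R]_n) v : posdef G -> (v <= V)%MS ->
  metric_norm G' (v *m J) <= opnorm G G' J V * metric_norm G v.
Proof.
move=> pG vV; have [->|v0] := eqVneq v 0.
  by rewrite mul0mx !metric_normE /gdot !mul0mx mxE sqrtr0 mulr0.
have nv := metric_norm_gt0 pG v0.
rewrite -ler_pdivrMr//.
have [_ ub] := metric_norm_bounded G' J V pG.
apply: sup_ubound => //; exists ((metric_norm G v)^-1 *: v).
  split; first exact: scalemx_sub.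
  by rewrite metric_normZ ger0_norm ?invr_ge0 ?(ltW nv)// mulVf// gt_eqF.
by rewrite -scalemxAl metric_normZ ger0_norm ?invr_ge0 ?(ltW nv)// mulrC.
Qed.

(** For a positive [a] in [P], the bound c/a holds on all of [Q], hence for [sup Q]; then c / sup Q
    bounds [P]. When [sup Q] is 0, be it a true supremum or the default value, the product is 0. *)
Lemma mul_sup_le (P Q : set R) c : P !=set0 -> Q !=set0 -> 0 <= c ->
  (forall a, P a -> 0 <= a) -> (forall b, Q b -> 0 <= b) ->
  (forall a b, P a -> Q b -> a * b <= c) -> sup P * sup Q <= c.
Proof.
move=> P0 Q0 c0 Pge Qge PQ.
have supQ : 0 <= sup Q.
  have [[[b Qb] ub]|/sup_out->//] := pselect (has_sup Q).
  by rewrite (le_trans (Qge b Qb))// sup_ubound//.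
have [->|sQ] := eqVneq (sup Q) 0; first by rewrite mulr0.
have sQ0 : 0 < sup Q by rewrite lt0r sQ.
rewrite -ler_pdivlMr//; apply: ge_sup => // a Pa.
rewrite ler_pdivlMr//; have [->|a0] := eqVneq a 0; first by rewrite mul0r.
have a_gt0 : 0 < a by rewrite lt0r a0 Pge.
rewrite mulrC -ler_pdivlMr//; apply: ge_sup => // b Qb.
by rewrite ler_pdivlMr// mulrC; exact: PQ.
Qed.

Lemma opnorm_mul_le n (G1 G1' J1 V1 G2 G2' J2 V2 : 'M[R]_n) c : 0 <= c ->
  (forall u v, (u <= V1)%MS -> metric_norm G1 u <= 1 ->
     (v <= V2)%MS -> metric_norm G2 v <= 1 ->
     metric_norm G1' (u *m J1) * metric_norm G2' (v *m J2) <= c) ->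
  opnorm G1 G1' J1 V1 * opnorm G2 G2' J2 V2 <= c.
Proof.
move=> c0 H; apply: mul_sup_le => //.
- exists (metric_norm G1' (0 *m J1)); exists 0 => //; split; first exact: sub0mx.
  by rewrite metric_normE /gdot !mul0mx mxE sqrtr0.
- exists (metric_norm G2' (0 *m J2)); exists 0 => //; split; first exact: sub0mx.
  by rewrite metric_normE /gdot !mul0mx mxE sqrtr0.
- by move=> _ [v _ <-]; exact: sqrtr_ge0.
- by move=> _ [v _ <-]; exact: sqrtr_ge0.
- by move=> _ _ [u [uV u1] <-] [v [vV v1] <-]; exact: H.
Qed.

(** Frees [absdet] from the basis chosen by [row_base]: a change of basis [P] multiplies both Gram
    determinants by the square of its determinant. *)
Lemma absdetE n r (G G' J L : 'M[R]_n) (B : 'M[R]_(r, n)) :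
  row_free B -> (B :=: L)%MS ->
  absdet G G' J L =
  Num.sqrt (\det ((B *m J) *m G' *m (B *m J)^T) / \det (B *m G *m B^T)).
Proof.
move=> fB BL.
have rL : r = \rank L by rewrite -(eqP fB) BL.
subst r; rewrite /absdet.
have /submxP[P EP] : (B <= row_base L)%MS by rewrite eq_row_base BL.
have uP : P \in unitmx.
  rewrite -row_free_unit /row_free eqn_leq rank_leq_row /=.
  have := mxrankM_maxl P (row_base L); rewrite -EP.
  by move: (eqP fB) => /= {1}->.
have dP : \det P != 0 by rewrite -unitfE -unitmxE.
congr Num.sqrt; rewrite EP.
set C := row_base L.
have -> : P *m C *m J *m G' *m (P *m C *m J)^T =
    P *m (C *m J *m G' *m (C *m J)^T) *m P^T by rewrite -(mulmxA P C J) trmx_mul !mulmxA.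
have -> : P *m C *m G *m (P *m C)^T = P *m (C *m G *m C^T) *m P^T.
  by rewrite trmx_mul !mulmxA.
rewrite !det_mulmx det_tr.
set a := \det (C *m J *m _ *m _); set b := \det (C *m _ *m _); set d := \det P.
by rewrite (mulrAC d a) (mulrAC d b) -mulf_div divff ?mul1r// mulf_neq0.
Qed.

Lemma det_gram2 n (G : 'M[R]_n) (u v : 'rV[R]_n) : posdef G ->
  \det (col_mx u v *m G *m (col_mx u v)^T) =
  gdot G u u * gdot G v v - gdot G u v ^+ 2.
Proof.
move=> pG; rewrite tr_col_mx mul_col_mx mul_col_row.
rewrite [u *m G *m u^T]mx11_scalar [u *m G *m v^T]mx11_scalar.
rewrite [v *m G *m u^T]mx11_scalar [v *m G *m v^T]mx11_scalar.
rewrite -!/(gdot G _ _) (gdotC v u pG).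
rewrite (expand_det_row _ (lshift 1 ord0)) big_split_ord !big_ord1.
have l1 : @lift (1 + 1) (lshift 1 (ord0 : 'I_1)) (ord0 : 'I_1) = rshift 1 ord0 :> 'I_(1 + 1) by exact: val_inj.
have l2 : @lift (1 + 1) (rshift 1 (ord0 : 'I_1)) (ord0 : 'I_1) = lshift 1 ord0 :> 'I_(1 + 1) by exact: val_inj.
rewrite /= block_mxEul block_mxEur /cofactor !det_mx11 /row' /col' !mxE l1 l2.
have sp : fintype.split (rshift 1 (ord0 : 'I_1)) = inr ord0 :> 'I_1 + 'I_1.
  exact: unsplitK (inr ord0).
by rewrite !sp row_mxEl row_mxEr !mxE /=; ring.
Qed.

End Forms.

(* Locked: otherwise unification unfolds it when comparing two times. *)
HB.lock Definition flow_dot (R : realType) (n : nat) (M : topologicalType)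
    (A : smooth_atlas R n M) (g : M -> 'M[R]_n) (D : R -> set M)
    (phi : R -> M -> M) (t : R) (x : M) (u w : 'rV[R]_n) : R :=
  let J := flow_deriv A D phi t x in gdot (g (phi t x)) (u *m J) (w *m J).
Arguments flow_dot {R n M} A g D phi t x u w.

(** * Compactness over pairs of vectors of the splitting *)

Section Splitting.
Variables (R : realType) (n : nat) (M : topologicalType).
Variable A : smooth_atlas R n M.
Variables (g : M -> 'M[R]_n) (X : M -> 'rV[R]_n).
Variables (D : R -> set M) (phi : R -> M -> M).
Hypothesis hg : riemannian_metric A g.
Hypothesis hphi : is_flow A X D phi.
Variables (Lam : set M) (E F : M -> 'M[R]_n).
Hypothesis Lam_compact : compact Lam.
Hypothesis hEF : invariant_splitting A D phi Lam E F.
Implicit Types (x y : M) (s t : R) (u v w : 'rV[R]_n).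

Local Notation J := (flow_deriv A D phi).
Local Notation tau x y := (transition (pref A x) (pref A y) y).

Local Notation gd := (flow_dot A g D phi).

Lemma flow_dotE t x u w : gd t x u w = gdot (g (phi t x)) (u *m J t x) (w *m J t x).
Proof. by rewrite unlock. Qed.

Lemma posdef_metric x : posdef (g x).
Proof. by have [gT g0 _] := hg; split => // v; exact: g0. Qed.

Lemma tau_id x : tau x x = 1%:M.
Proof. by rewrite (transitionE hphi) (tangent_id hphi)//; exact: pref_dom. Qed.

Lemma flow_dot_pullback x0 t y u w :
  gd t y (u *m tau x0 y) (w *m tau x0 y) =
  gdot (pullback_metric A g D phi x0 t y) u w.
Proof. by rewrite flow_dotE /gdot /pullback_metric !trmx_mul !mulmxA. Qed.

Lemma flow_dot_cvg (T : Type) (G : set_system T) {FG : Filter G}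
    (t : T -> R) (y : T -> M) (u w : T -> 'rV[R]_n) t0 x0 u0 w0 :
  t @ G --> t0 -> 0 <= t0 -> (\forall z \near G, 0 <= t z) -> y @ G --> x0 ->
  u @ G --> u0 -> w @ G --> w0 ->
  gd (t z) (y z) (u z *m tau x0 (y z)) (w z *m tau x0 (y z)) @[z --> G] -->
  gd t0 x0 u0 w0.
Proof.
move=> tG t00 tge yG uG wG.
under eq_cvg do rewrite flow_dot_pullback.
rewrite -[u0]mulmx1 -[w0]mulmx1 -(tau_id x0) flow_dot_pullback.
apply: gdot_cvg => //.
have tyG : (t z, y z) @[z --> G] --> within [set p | 0 <= p.1] (nbhs (t0, x0)).
  have ty : (t z, y z) @[z --> G] --> (t0, x0) by exact: (cvg_pair tG yG).
  by apply: (cvg_into_within ty); exact: tge.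
exact: (cvg_comp _ _ tyG (pullback_metric_cvg hphi hg t00)).
Qed.

(** Stands in for the compactness of the unit vectors of E and F. Homogeneity reduces nonzero
    vectors to frame combinations with coefficients of norm 1. The filter [G] is left free so that
    the parameter [i] can be a small angle or speed, a large constant or a large time. *)
Lemma splitting_compact (I : Type) (G : set_system I) {FG : Filter G}
    (Q : I -> M -> 'rV[R]_n -> 'rV[R]_n -> Prop) :
  (forall i y u w a b, a != 0 -> b != 0 -> Q i y u w -> Q i y (a *: u) (b *: w)) ->
  (forall x u w, Lam x -> (u <= E x)%MS -> (w <= F x)%MS -> u != 0 -> w != 0 ->
     \forall z \near (x, (u, w)) & i \near G, Lam z.1 ->
       Q i z.1 (z.2.1 *m tau x z.1) (z.2.2 *m tau x z.1)) ->
  \forall i \near G, forall x u w, Lam x -> (u <= E x)%MS -> (w <= F x)%MS ->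
     u != 0 -> w != 0 -> Q i x u w.
Proof.
move=> Qhom Qloc.
suff : \forall i \near G, Lam `<=` (fun x => forall u w, (u <= E x)%MS ->
    (w <= F x)%MS -> u != 0 -> w != 0 -> Q i x u w).
  by apply: filterS => i H x u w Lx; exact: H.
have /compact_near_coveringP/near_covering_withinP := Lam_compact; apply.
move=> x Lx; have [_ _ [/(_ x Lx) cE /(_ x Lx) cF] _] := hEF.
have [k [U [B [oU Ux Udom Bc BE]]]] := cE.
have [k' [U' [B' [oU' Ux' Udom' Bc' BF]]]] := cF.
(* Near x, a nonzero vector of the subbundle is a nonzero multiple of a unit coefficient row applied
   to the frame, carried back from the chart of x. *)
have frameP m (V : set M) (C : M -> 'M[R]_(m, n)) (W : M -> 'M[R]_n) :
    V `<=` chart_dom (pref A x) ->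
    (forall y, Lam y -> V y -> row_free (C y) /\
       (C y :=: W y *m transition (pref A y) (pref A x) y)%MS) ->
    forall y v, Lam y -> V y -> (v <= W y)%MS -> v != 0 ->
    exists a c, [/\ `|c : 'rV[R]_m| = 1, a != 0 & v = a *: (c *m C y *m tau x y)].
  move=> Vdom CW y v Ly Vy vW v0.
  have [_ CyW] := CW y Ly Vy.
  have : (v *m transition (pref A y) (pref A x) y <= C y)%MS.
    by rewrite CyW submxMr.
  move=> /submxP[c Ec].
  have vE : v = c *m C y *m tau x y.
    rewrite -Ec -mulmxA (transitionK hphi) ?mulmx1//; first exact: pref_dom.
    exact: Vdom.
  have c0 : `|c| != 0.
    by apply: contra v0; rewrite normr_eq0 => /eqP c0; rewrite vE c0 !mul0mx.
  exists `|c|, (`|c|^-1 *: c); split => //.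
    by rewrite normrZ normfV normr_id mulVf.
  by rewrite -!scalemxAl scalerA mulfV// scale1r.
pose S := [set c : 'rV[R]_k | `|c| = 1] `*` [set c : 'rV[R]_k' | `|c| = 1].
have cS : compact S by apply: compact_setX; exact: sphere_compact.
(* Compactness of the coefficient spheres, with (y, i) as the parameter: a single neighbourhood of x
   then serves all directions. *)
have /compact_near_coveringP := cS.
move=> /(_ _ (filter_prod (nbhs x) G) (fun yi ab => Lam yi.1 ->
  Q yi.2 yi.1 (ab.1 *m B yi.1 *m tau x yi.1) (ab.2 *m B' yi.1 *m tau x yi.1))).
move=> /(_ _) [|[N GN] [/= xN GGN NP]].
- move=> [a b] [/= a1 b1].
  have [fB BEx] := BE x Lx Ux; have [fB' BFx] := BF x Lx Ux'.
  have uE : (a *m B x <= E x)%MS.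
    by rewrite (submx_trans (submxMl a (B x)))// BEx tau_id mulmx1.
  have wF : (b *m B' x <= F x)%MS.
    by rewrite (submx_trans (submxMl b (B' x)))// BFx tau_id mulmx1.
  have u0 : a *m B x != 0.
    by rewrite mulmx_free_eq0// -normr_eq0 a1 oner_eq0.
  have w0 : b *m B' x != 0.
    by rewrite mulmx_free_eq0// -normr_eq0 b1 oner_eq0.
  have [[/= Z Gi] [/= nZ GGi] ZP] := Qloc x _ _ Lx uE wF u0 w0.
  have Bc1 : B @ within (Lam `&` U) (nbhs x) --> B x.
    by have /subspace_continuousP := Bc; apply.
  have Bc1' : B' @ within (Lam `&` U') (nbhs x) --> B' x.
    by have /subspace_continuousP := Bc'; apply.
  have Bc2 : B @ within (Lam `&` U `&` U') (nbhs x) --> B x.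
    by apply: cvg_within_subset Bc1 => y [].
  have Bc2' : B' @ within (Lam `&` U `&` U') (nbhs x) --> B' x.
    by apply: cvg_within_subset Bc1' => y [[]].
  pose H := filter_prod (nbhs (a, b)) (within (Lam `&` U `&` U') (nbhs x)).
  have c1 : (fun z : ('rV[R]_k * 'rV[R]_k') * M => z.1.1) @ H --> a.
    exact: cvg_comp (@cvg_fst _ _ _ _ _) (@cvg_fst _ _ (nbhs a) (nbhs b) _).
  have c2 : (fun z : ('rV[R]_k * 'rV[R]_k') * M => z.1.2) @ H --> b.
    exact: cvg_comp (@cvg_fst _ _ _ _ _) (@cvg_snd _ _ (nbhs a) (nbhs b) _).
  have c3 : (fun z : ('rV[R]_k * 'rV[R]_k') * M => z.2) @ H -->
      within (Lam `&` U `&` U') (nbhs x) by exact: cvg_snd.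
  have c4 : (fun z : ('rV[R]_k * 'rV[R]_k') * M => z.2) @ H --> x.
    by apply: cvg_trans c3 _; exact: cvg_within.
  have c5 : (z.2, (z.1.1 *m B z.2, z.1.2 *m B' z.2)) @[z --> H] --> (x, (a *m B x, b *m B' x)) by exact: cvg_pair c4 (cvg_pair (cvg_mulmx c1 (cvg_comp _ _ c3 Bc2))
    (cvg_mulmx c2 (cvg_comp _ _ c3 Bc2'))).
  have [[/= V1 V2] [/= nV1 nV2] VZ] := c5 _ nZ.
  exists (V1, [set yi | [/\ (Lam `&` U `&` U') yi.1 -> V2 yi.1, U yi.1, U' yi.1 & Gi yi.2]]) => /=.
    split => //; exists (U `&` U' `&` [set y | (Lam `&` U `&` U') y -> V2 y], Gi) => /=.
      split => //; apply: filterI => //.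
      by apply: filterI; exact: open_nbhs_nbhs.
    by move=> [y i] [[[]]].
  move=> [[a' b'] [y i]] [/= V1ab [Vy Uy Uy' iG]] Ly.
  apply: (ZP (y, (a' *m B y, b' *m B' y), i)) => //=; split => //=.
  by apply: (VZ ((a', b'), y)); split => //=; exact: Vy.
- exists (U `&` U' `&` N, GN) => /=.
    by split => //; apply: filterI => //; apply: filterI; exact: open_nbhs_nbhs.
  move=> [y i] [/= [[Uy Uy'] Ny] iG] Ly u w uE wF u0 w0.
  have [a [c [c1 a0 ->]]] := frameP _ _ _ _ Udom BE y u Ly Uy uE u0.
  have [b [d [d1 b0 ->]]] := frameP _ _ _ _ Udom' BF y w Ly Uy' wF w0.
  apply: Qhom => //.
  by apply: (NP (y, i) _ (c, d)).
Qed.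

End Splitting.

(** * Scalar estimates: exponential decay and ratios of squared norms *)

Lemma expR_decay_le0 (R : realType) (c K l : R) : 0 < l ->
  (forall k : nat, (0 < k)%N -> c <= K * expR (- l * k%:R)) -> c <= 0.
Proof.
move=> l0 H; rewrite leNgt; apply/negP => c0.
have [k] : exists k : nat, `|K| / (c * l) < k%:R.
  exists (Num.bound (`|K| / (c * l))); apply: archi_boundP.
  by rewrite divr_ge0// mulr_ge0// ltW.
rewrite ltr_pdivrMr ?mulr_gt0// => kK.
have k_gt0 : (0 < k)%N.
  by rewrite lt0n; apply: contraTneq kK => ->; rewrite mul0r -leNgt.
have := H k k_gt0; rewrite mulNr expRN ler_pdivlMr ?expR_gt0// leNgt => /negP; apply.
rewrite (le_lt_trans (ler_norm K))// (lt_le_trans kK)//.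
rewrite mulrCA ler_pM2l// (le_trans _ (expR_ge1Dx _))// mulrC lerDr//.
Qed.

Lemma near_pair (T U : Type) (F : set_system T) (G : set_system U)
    (P : T -> Prop) (S : U -> Prop) (Q : T * U -> Prop) :
  F P -> G S -> (forall x y, P x -> S y -> Q (x, y)) -> filter_prod F G Q.
Proof.
by move=> FP GS PSQ; exists (P, S) => //= -[x y] [/= Px Sy]; exact: PSQ.
Qed.

Lemma ler_scale (R : realType) (a b c p q r s : R) :
  p * q <= c * (r * s) -> a * a * p * (b * b * q) <= c * (a * a * r * (b * b * s)).
Proof.
move=> H; have -> : a * a * p * (b * b * q) = (a * b) ^+ 2 * (p * q) by ring.
have -> : c * (a * a * r * (b * b * s)) = (a * b) ^+ 2 * (c * (r * s)) by ring.
by rewrite ler_wpM2l// sqr_ge0.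
Qed.

Lemma ltr_scale (R : realType) (a b c p q r s : R) : a != 0 -> b != 0 ->
  c * (p * q) < r * s -> c * (a * a * p * (b * b * q)) < a * a * r * (b * b * s).
Proof.
move=> a0 b0 H.
have -> : c * (a * a * p * (b * b * q)) = (a * b) ^+ 2 * (c * (p * q)) by ring.
have -> : a * a * r * (b * b * s) = (a * b) ^+ 2 * (r * s) by ring.
by rewrite ltr_pM2l// exprn_even_gt0//= mulf_neq0.
Qed.

Lemma expR_decay_lt (R : realType) (K l e : R) : 0 <= K -> 0 < l -> 0 < e ->
  exists2 k0, (0 < k0)%N & forall k, (k0 <= k)%N -> K * expR (- l * k%:R) < e.
Proof.
move=> K0 l0 e0.
have [k0 kP] : exists k : nat, K / (e * l) < k%:R.
  exists (Num.bound (K / (e * l))); apply: archi_boundP.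
  by rewrite divr_ge0// mulr_ge0// ltW.
exists k0.+1 => // k kk.
have {}kP : K < k%:R * (e * l).
  rewrite -ltr_pdivrMr ?mulr_gt0// (lt_le_trans kP)// ler_nat ltnW//.
rewrite mulNr expRN ltr_pdivrMr ?expR_gt0// (lt_le_trans kP)//.
rewrite mulrCA ler_pM2l// (le_trans _ (expR_ge1Dx _))// mulrC lerDr//.
Qed.

(** For the pair u, w: e, b are squared norms at time 0, d, c at an intermediate time and a, f at
    the final time. The exponential loses a factor q over the intermediate step, and the gain 4 of
    that step pays for it. *)
Lemma ratio_step_le (R : realType) (Q q r a b e f d c : R) :
  0 <= Q -> 0 <= q -> q <= 4 -> 0 <= r -> 0 <= b -> 0 <= e -> 0 <= f -> 0 < c ->
  a * c <= Q * q * r * (d * f) -> 4 * (d * b) < e * c ->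
  a * b <= Q * r * (e * f).
Proof.
move=> Q0 q0 q4 r0 b0 e0 f0 c0 H1 H2.
rewrite -(ler_pM2r c0) mulrAC.
apply: (le_trans (ler_wpM2r b0 H1)).
have -> : Q * q * r * (d * f) * b = Q * r * f / 4 * q * (4 * (d * b)) by field.
have W : 0 <= Q * r * f / 4 by rewrite divr_ge0// !mulr_ge0.
apply: (@le_trans _ _ (Q * r * f / 4 * q * (e * c))).
  by rewrite ler_wpM2l ?(ltW H2)// mulr_ge0.
apply: (@le_trans _ _ (Q * r * f / 4 * 4 * (e * c))).
  by rewrite ler_wpM2r ?mulr_ge0 ?(ltW c0)// ler_wpM2l.
by rewrite le_eqVlt; apply/orP; left; apply/eqP; field.
Qed.

(* Here a, b (resp. c, e) are the squared norms of the two vectors at the time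
   reached so far (resp. after the next step). *)
Lemma ratio_pow_step (R : realType) (q a b a0 b0 c e : R) : 0 <= q ->
  q * (a * b0) <= a0 * b -> 0 <= b0 -> 0 < b -> 0 < a ->
  0 <= e -> 4 * (c * b) < a * e -> 4 * q * (c * b0) <= a0 * e.
Proof.
move=> q0 H1 b00 bp ap e0 H2.
rewrite -(ler_pM2r (mulr_gt0 ap bp)).
have -> : 4 * q * (c * b0) * (a * b) = q * (a * b0) * (4 * (c * b)) by ring.
have H3 : q * (a * b0) * (4 * (c * b)) <= q * (a * b0) * (a * e).
  by rewrite ler_wpM2l ?(ltW H2)// !mulr_ge0 ?(ltW ap).
apply: (le_trans H3).
have := ler_wpM2r (mulr_ge0 (ltW ap) e0) H1 => /le_trans; apply.
by rewrite le_eqVlt; apply/orP; left; apply/eqP; ring.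
Qed.

(** Eliminates p and e, the squared norms at the final time. What remains bounds q, later a power of
    4, by norms at two fixed earlier times. *)
Lemma ratio_pow_bound (R : realType) (q a b p s0 c e : R) :
  0 < a -> 0 < b -> 0 < p -> q * (p * c) <= b * e -> a * e <= 4 * (p * s0) ->
  q * (c * a) <= 4 * (b * s0).
Proof.
move=> a0 b0 p0 H1 H2; rewrite -(ler_pM2r p0).
have := ler_wpM2r (ltW a0) H1; have := ler_wpM2l (ltW b0) H2; nra.
Qed.

(** * Dynamics on the splitting and the proof of domination *)

Section Domination.
Variables (R : realType) (n : nat) (M : topologicalType).
Variable A : smooth_atlas R n M.
Variables (g : M -> 'M[R]_n) (X : M -> 'rV[R]_n).
Variables (D : R -> set M) (phi : R -> M -> M).
Hypothesis hg : riemannian_metric A g.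
Hypothesis hX : C1_vector_field A X.
Hypothesis hphi : is_flow A X D phi.
Variables (Lam : set M) (E F : M -> 'M[R]_n).
Hypothesis Lam_compact : compact Lam.
Hypothesis Lam_invariant : invariant_set D phi Lam.
Hypothesis hEF : invariant_splitting A D phi Lam E F.
Implicit Types (x y : M) (s t : R) (u v w : 'rV[R]_n) (k m : nat).

Local Notation J := (flow_deriv A D phi).
Local Notation gd := (flow_dot A g D phi).
Local Notation nsq t x u := (flow_dot A g D phi t x u u).
Local Notation tau x y := (transition (pref A x) (pref A y) y).
Let pg := posdef_metric hg.

Lemma Lam_dom x : Lam x -> forall t, D t x.
Proof. by move=> Lx t; have [/(_ _ Lx)] := Lam_invariant t. Qed.

Lemma Lam_phi t x : Lam x -> Lam (phi t x).
Proof. by move=> Lx; have [_ <-] := Lam_invariant t; exists x. Qed.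

Lemma flow_dot0 x u w : gd 0 x u w = gdot (g x) u w.
Proof. by rewrite !flow_dotE (phi0 hphi) (flow_deriv0 hphi) !mulmx1. Qed.

Lemma flow_dotD s t x u w : 0 <= s -> 0 <= t ->
  gd t (phi s x) (u *m J s x) (w *m J s x) = gd (t + s) x u w.
Proof.
move=> s0 t0; rewrite !flow_dotE (flow_derivD hphi) ?addr_ge0//.
by rewrite (phiD hphi) ?addr_ge0// !mulmxA.
Qed.

Lemma flow_dotZ t x a b u w : gd t x (a *: u) (b *: w) = a * b * gd t x u w.
Proof. by rewrite !flow_dotE -!scalemxAl gdotZl gdotZr mulrA. Qed.

Lemma nsq0 t x : nsq t x 0 = 0.
Proof. by rewrite flow_dotE /gdot !mul0mx mxE. Qed.

Lemma mulmx_flow_neq0 t x u : 0 <= t -> u != 0 -> u *m J t x != 0.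
Proof.
move=> t0; apply: contra => /eqP uJ.
by rewrite -[u]mulmx1 -(flow_derivK hphi x t0) mulmxA uJ mul0mx.
Qed.

Lemma nsq_ge0 t x u : 0 <= nsq t x u.
Proof. by rewrite flow_dotE gdot_ge0. Qed.

Lemma nsq_gt0 t x u : 0 <= t -> u != 0 -> 0 < nsq t x u.
Proof. by move=> t0 u0; rewrite flow_dotE gdot_gt0// mulmx_flow_neq0. Qed.

Lemma subE_flow t x u : Lam x -> (u <= E x)%MS -> (u *m J t x <= E (phi t x))%MS.
Proof.
by move=> Lx uE; have [_ _ _ [H _]] := hEF; rewrite -(H t x Lx) submxMr.
Qed.

Lemma subF_flow t x u : Lam x -> (u <= F x)%MS -> (u *m J t x <= F (phi t x))%MS.
Proof.
by move=> Lx uE; have [_ _ _ [_ H]] := hEF; rewrite -(H t x Lx) submxMr.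
Qed.

Lemma nsq_le_sqr c t x u :
  metric_norm (g (phi t x)) (u *m J t x) <= c * metric_norm (g x) u ->
  nsq t x u <= c ^+ 2 * nsq 0 x u.
Proof.
move=> H; rewrite flow_dot0 !flow_dotE -!metric_norm_sqr// -exprMn.
by rewrite ler_pXn2r// nnegrE ?(le_trans _ H) ?sqrtr_ge0.
Qed.

Lemma sqr_mul_expR (C l t : R) :
  (C * expR (- l * t)) ^+ 2 = C ^+ 2 * expR (- (2 * l) * t).
Proof. by rewrite exprMn [expR _ ^+ 2]expr2 -expRD; congr (_ * expR _); ring. Qed.

Lemma contraction : uniformly_contracted A g D phi Lam E ->
  exists C l : R, [/\ 0 < C, 0 < l & forall x t u, Lam x -> 0 <= t ->
    (u <= E x)%MS -> nsq t x u <= C * expR (- l * t) * nsq 0 x u].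
Proof.
move=> [C [l [C0 l0 H]]]; exists (C ^+ 2), (2 * l).
split; [by rewrite exprn_gt0|by rewrite mulr_gt0|move=> x t u Lx t0 uE].
rewrite -sqr_mul_expR; apply: nsq_le_sqr.
apply: (le_trans (le_opnorm _ _ (pg x) uE)).
by apply: ler_wpM2r; [exact: sqrtr_ge0|exact: H].
Qed.

(** A singularity is fixed by the flow, so the derivative at time -t there inverts the one at time
    t. Applied to DX_t w, the bound on DX_(-t) over F controls w itself. *)
Lemma singular_domination : dominated_at_singularities A g X D phi Lam E F ->
  exists C l : R, [/\ 0 < C, 0 < l & forall x t u w, Lam x -> singularity X x ->
    0 <= t -> (u <= E x)%MS -> (w <= F x)%MS ->
    nsq t x u * nsq 0 x w <= C * expR (- l * t) * (nsq 0 x u * nsq t x w)].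
Proof.
move=> [C [l [C0 l0 H]]]; exists (C ^+ 2), (2 * l).
split; [by rewrite exprn_gt0|by rewrite mulr_gt0|move=> x t u w Lx Xx t0 uE wF].
have px : phi t x = x := singularity_fixed hphi (Lam_dom Lx) Xx t0.
have pNx : phi (- t) x = x by rewrite -[X in phi _ X]px (phiNK hphi).
have h1 := le_opnorm (g (phi t x)) (J t x) (pg x) uE.
have wF' : (w *m J t x <= F x)%MS by rewrite -[X in F X]px subF_flow.
have h2 := le_opnorm (g (phi (- t) x)) (J (- t) x) (pg x) wF'.
rewrite -mulmxA -[X in J (- t) X]px (flow_derivK hphi)// mulmx1 in h2.
have h3 := ltW (H x t Lx Xx t0).
rewrite -sqr_mul_expR !flow_dot0 !flow_dotE -!metric_norm_sqr// -!exprMn.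
rewrite ler_pXn2r ?nnegrE ?mulr_ge0 ?expR_ge0 ?sqrtr_ge0 ?(ltW C0)//.
rewrite px pNx in h1 h2 *.
have := ler_pM (sqrtr_ge0 _) (sqrtr_ge0 _) h1 h2.
move=> /le_trans; apply.
rewrite mulrACA ler_wpM2r ?mulr_ge0 ?sqrtr_ge0//.
by move: h3; rewrite /flow_norm px pNx.
Qed.

Lemma point_cvg x u w :
  let G := nbhs (x, (u, w)) in
  [/\ z.1 @[z --> G] --> x, z.2.1 @[z --> G] --> u & z.2.2 @[z --> G] --> w].
Proof.
have c1 := @cvg_fst _ _ (nbhs x) (nbhs (u, w)) _.
have c2 := @cvg_snd _ _ (nbhs x) (nbhs (u, w)) _.
have c21 := @cvg_fst _ _ (nbhs u) (nbhs w) _.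
have c22 := @cvg_snd _ _ (nbhs u) (nbhs w) _.
move=> G; split; first exact: (c1 (nbhs_filter _)).
  exact: (cvg_comp _ _ (c2 (nbhs_filter _)) (c21 (nbhs_filter _))).
exact: (cvg_comp _ _ (c2 (nbhs_filter _)) (c22 (nbhs_filter _))).
Qed.

Lemma flow_dot_near t x u w : 0 <= t ->
  let G := nbhs (x, (u, w)) in
  [/\ nsq t z.1 (z.2.1 *m tau x z.1) @[z --> G] --> nsq t x u,
      nsq t z.1 (z.2.2 *m tau x z.1) @[z --> G] --> nsq t x w &
      gd t z.1 (z.2.1 *m tau x z.1) (z.2.2 *m tau x z.1) @[z --> G] --> gd t x u w].
Proof.
move=> t0; have [c1 c2 c3] := point_cvg x u w.
have ct : (fun=> t) z @[z --> nbhs (x, (u, w))] --> t by exact: cvg_cst.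
have ge0 : \forall z \near nbhs (x, (u, w)), 0 <= (fun=> t) z by exact: filterE.
by split; [exact: (flow_dot_cvg hg hphi ct t0 ge0 c1 c2 c2)
  |exact: (flow_dot_cvg hg hphi ct t0 ge0 c1 c3 c3)
  |exact: (flow_dot_cvg hg hphi ct t0 ge0 c1 c2 c3)].
Qed.

Lemma disjointEF x u : Lam x -> (u <= E x)%MS -> (u <= F x)%MS -> u = 0.
Proof.
move=> Lx uE uF; have [/(_ x Lx) [_ EF0] _ _ _] := hEF.
by apply/eqP; rewrite -submx0 -EF0 sub_capmx uE.
Qed.

(** Bounds the projection onto E along F. Strict Cauchy-Schwarz holds because E and F meet only in
    0, and compactness makes the gap d uniform; then |u+w|^2 - d |u|^2 is nonnegative by a
    discriminant argument. *)
Lemma angle : exists2 d : R, 0 < d & forall x u w, Lam x ->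
  (u <= E x)%MS -> (w <= F x)%MS -> nsq 0 x u <= d^-1 * nsq 0 x (u + w).
Proof.
pose Q (d : R) y u w := gd 0 y u w ^+ 2 <= (1 - d) * (nsq 0 y u * nsq 0 y w).
have : \forall d \near (0:R)^'+, forall x u w, Lam x ->
    (u <= E x)%MS -> (w <= F x)%MS -> u != 0 -> w != 0 -> Q d x u w.
  apply: (splitting_compact hphi Lam_compact hEF).
  - move=> d y u w a b a0 b0; rewrite /Q !flow_dotZ => H.
    have -> : (a * b * gd 0 y u w) ^+ 2 = a * a * gd 0 y u w * (b * b * gd 0 y u w).
      by rewrite expr2; move: (gd 0 y u w) => r; ring.
    by apply: ler_scale; rewrite -expr2.
  - move=> x u w Lx uE wF u0 w0.
    have [c1 c2 c3] := flow_dot_near x u w (lexx 0).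
    have lt1 : gd 0 x u w ^+ 2 < nsq 0 x u * nsq 0 x w.
      rewrite !flow_dot0; apply: cauchy_schwarz_strict => //.
      apply: contra u0 => uw; apply/eqP; apply: (disjointEF Lx uE).
      exact: submx_trans uw wF.
    have p0 : 0 < nsq 0 x u * nsq 0 x w by rewrite mulr_gt0 ?nsq_gt0.
    (* The squared cosine of the angle. Taking half of its distance to 1 as [d] keeps the inequality
       strict, hence stable near x. *)
    pose r := gd 0 x u w ^+ 2 / (nsq 0 x u * nsq 0 x w).
    have r1 : r < 1 by rewrite ltr_pdivrMr// mul1r.
    pose d := (1 - r) / 2.
    have d0 : 0 < d by rewrite divr_gt0// subr_gt0.
    have lt2 : gd 0 x u w ^+ 2 < (1 - d) * (nsq 0 x u * nsq 0 x w).
      rewrite -ltr_pdivrMr//; rewrite -/r /d; lra.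
    have Z : \forall z \near nbhs (x, (u, w)),
        gd 0 z.1 (z.2.1 *m tau x z.1) (z.2.2 *m tau x z.1) *
        gd 0 z.1 (z.2.1 *m tau x z.1) (z.2.2 *m tau x z.1) <
        (1 - d) * (nsq 0 z.1 (z.2.1 *m tau x z.1) * nsq 0 z.1 (z.2.2 *m tau x z.1)).
      exact: (cvg_lt_near (cvgM c3 c3) (cvgM (cvg_cst (1 - d)) (cvgM c1 c2)) lt2).
    apply: (near_pair Z (nbhs_right_lt d0)) => z d' zZ d'd _.
    rewrite /Q /= expr2; apply: (le_trans (ltW zZ)).
    by rewrite ler_wpM2r ?mulr_ge0 ?nsq_ge0// lerB// ltW.
move=> H; have [d [d0 [d1 {}H]]] := filter_ex (filterI (nbhs_right_gt (0 : R))
  (filterI (nbhs_right_lt ltr01) H)).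
exists d => // x u w Lx uE wF.
have E1 : nsq 0 x (u + w) = nsq 0 x u + gd 0 x u w *+ 2 + nsq 0 x w.
  rewrite !flow_dot0 !(gdotDl, gdotDr) (gdotC w u)//; ring.
have b2 : gd 0 x u w ^+ 2 <= (1 - d) * (nsq 0 x u * nsq 0 x w).
  have [->|u0] := eqVneq u 0.
    by rewrite !flow_dot0 /gdot !mul0mx mxE expr0n mul0r mulr0.
  have [->|w0] := eqVneq w 0.
    by rewrite !flow_dot0 /gdot trmx0 !mulmx0 mxE expr0n !mulr0.
  exact: H.
rewrite ler_pdivlMl// E1.
have := nsq_ge0 0 x u; have := nsq_ge0 0 x w; move: b2.
set a := nsq 0 x u; set b := gd 0 x u w; set c := nsq 0 x w => b2 c0 a0.
rewrite -subr_ge0.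
have -> : a + b *+ 2 + c - d * a = (1 - d) * a + c + b *+ 2 by ring.
have : 0 <= (1 - d) * a by rewrite mulr_ge0// subr_ge0 ltW.
move: b2; rewrite mulrA; set a' := (1 - d) * a => b2 a'0.
rewrite leNgt; apply/negP => lt0.
have := sqr_ge0 (a' - c); nra.
Qed.

Local Notation speed x := (gdot (g x) (X x) (X x)).

Lemma vf_bounded : exists2 K : R, 0 <= K & forall x, Lam x -> speed x <= K.
Proof.
have H : \forall K \near +oo, Lam `<=` (fun x => speed x <= K).
  have /compact_near_coveringP := Lam_compact; apply => x Lx.
  have c : speed y @[y --> x] --> speed x.
    by apply: cvg_mx_entry; exact: (vf_norm_cvg hphi hg hX).
  have lt1 : speed x < speed x + 1 by rewrite ltrDl.
  have Z : \forall y \near x, speed y < speed x + 1.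
    exact: (cvg_lt_near c (cvg_cst _) lt1).
  apply: (near_pair Z (nbhs_pinfty_ge (num_real (speed x + 1)))) => y K yZ /= HK.
  exact: (le_trans (ltW yZ)).
have [K [K0 {}H]] := filter_ex (filterI (nbhs_pinfty_ge (num_real (0 : R))) H).
by exists K.
Qed.

Lemma splitting_sum x v : Lam x ->
  exists u w, [/\ (u <= E x)%MS, (w <= F x)%MS & v = u + w].
Proof.
move=> Lx; have [/(_ x Lx) [EF1 _] _ _ _] := hEF.
have : (v <= E x + F x)%MS by rewrite EF1 submx1.
move=> /sub_addsmxP[[a b] /= ->]; exists (a *m E x), (b *m F x).
by split => //; exact: submxMl.
Qed.

(* A component of X along E would be contracted forward from arbitrarily far in
   the past, where it is bounded. *)
Lemma vf_subF x : uniformly_contracted A g D phi Lam E -> Lam x -> (X x <= F x)%MS.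
Proof.
move=> /contraction[C [l [C0 l0 HC]]] Lx.
have [d d0 Hd] := angle; have [K K0 HK] := vf_bounded.
have [u [w [uE wF XE]]] := splitting_sum (X x) Lx.
suff : nsq 0 x u <= 0.
  have [u0|u0] := eqVneq u 0; first by rewrite XE u0 add0r.
  by rewrite leNgt nsq_gt0.
apply: (@expR_decay_le0 _ _ (C * (d^-1 * K)) l) => // k _.
have k0 : 0 <= k%:R :> R by [].
(* Surjectivity of X_k on Lambda provides the point y of the orbit k units of time in the past. *)
have [_ /seteqP[_ /(_ _ Lx) [y Ly yx]]] := Lam_invariant k%:R.
have [u' [w' [uE' wF' XE']]] := splitting_sum (X y) Ly.
have E1 : u + w = u' *m J k%:R y + w' *m J k%:R y.
  by rewrite -XE -yx -(vf_flow hphi (Lam_dom Ly) k0) XE' mulmxDl.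
have uu : u = u' *m J k%:R y.
  apply/eqP; rewrite -subr_eq0; apply/eqP; apply: (disjointEF Lx).
    by rewrite addmx_sub// eqmx_opp -[X in E X]yx subE_flow.
  have -> : u - u' *m J k%:R y = w' *m J k%:R y - w.
    by apply/eqP; rewrite subr_eq addrAC [X in X - w]addrC -E1 addrK.
  by rewrite addmx_sub// ?eqmx_opp// -[X in F X]yx subF_flow.
have -> : nsq 0 x u = nsq k%:R y u'.
  by have := @flow_dotD k%:R 0 y u' u' k0 (lexx 0); rewrite yx -uu add0r.
rewrite (le_trans (HC _ _ _ Ly k0 uE'))// mulrAC ler_wpM2r ?expR_ge0//.
rewrite ler_wpM2l ?(ltW C0)// (le_trans (Hd _ _ _ Ly uE' wF'))//.
by rewrite -XE' flow_dot0 ler_wpM2l ?invr_ge0 ?(ltW d0)// HK.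
Qed.

(* These are squared norms, whence 4 for a ratio of norms below 1/2. *)
Definition eventually_dominated : Prop :=
  forall x u w, Lam x -> (u <= E x)%MS -> (w <= F x)%MS -> u != 0 -> w != 0 ->
  exists2 k, (0 < k)%N &
    4 * (nsq k%:R x u * nsq 0 x w) < nsq 0 x u * nsq k%:R x w.

(** The strict inequality at a time k persists for nearby points and vectors, and k remains
    admissible for every larger N. *)
Lemma uniform_time : eventually_dominated ->
  exists N : nat, forall x u w, Lam x -> (u <= E x)%MS -> (w <= F x)%MS ->
  u != 0 -> w != 0 ->
  exists2 k, (0 < k <= N)%N &
    4 * (nsq k%:R x u * nsq 0 x w) < nsq 0 x u * nsq k%:R x w.
Proof.
move=> H.
pose Q N y u w := exists2 k, (0 < k <= N)%N &
    4 * (nsq k%:R y u * nsq 0 y w) < nsq 0 y u * nsq k%:R y w.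
have : \forall N \near \oo, forall x u w, Lam x ->
    (u <= E x)%MS -> (w <= F x)%MS -> u != 0 -> w != 0 -> Q N x u w.
  apply: (splitting_compact hphi Lam_compact hEF).
    move=> N y u w a b a0 b0 [k kN kH]; exists k => //; rewrite !flow_dotZ.
    exact: ltr_scale.
  move=> x u w Lx uE wF u0 w0.
  have [k k0 kH] := H x u w Lx uE wF u0 w0.
  have [c1 c2 _] := flow_dot_near x u w (lexx 0).
  have [c3 c4 _] := flow_dot_near x u w (ler0n R k).
  have Z : \forall z \near nbhs (x, (u, w)),
      4 * (nsq k%:R z.1 (z.2.1 *m tau x z.1) * nsq 0 z.1 (z.2.2 *m tau x z.1)) <
      nsq 0 z.1 (z.2.1 *m tau x z.1) * nsq k%:R z.1 (z.2.2 *m tau x z.1).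
    exact: (cvg_lt_near (cvgM (cvg_cst (4 : R)) (cvgM c3 c2)) (cvgM c1 c4) kH).
  apply: (near_pair Z (nbhs_infty_ge k)) => z N zZ /= kN _.
  by exists k => //; rewrite k0.
by move=> /filter_ex[N HN]; exists N.
Qed.

(** Controls the leftover times shorter than one full step. The quantification over t sits inside
    [Q], so compactness of the time interval is used at each (x, u, w) first. *)
Lemma bounded_distortion N : 0 <= N ->
  exists2 K : R, 0 <= K & forall x u w t, Lam x -> (u <= E x)%MS -> (w <= F x)%MS ->
    0 <= t <= N -> nsq t x u * nsq 0 x w <= K * (nsq 0 x u * nsq t x w).
Proof.
move=> N0.
pose Q (K : R) y u w := forall t, 0 <= t <= N ->
  nsq t y u * nsq 0 y w <= K * (nsq 0 y u * nsq t y w).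
have : \forall K \near +oo, forall x u w, Lam x ->
    (u <= E x)%MS -> (w <= F x)%MS -> u != 0 -> w != 0 -> Q K x u w.
  apply: (splitting_compact hphi Lam_compact hEF).
    move=> K y u w a b a0 b0 H t tN; rewrite !flow_dotZ.
    exact/ler_scale/H.
  move=> x u w Lx uE wF u0 w0.
  have /compact_near_coveringP/near_covering_withinP cov := @segment_compact R 0 N.
  pose P (zK : (M * ('rV[R]_n * 'rV[R]_n)) * R) (t : R) :=
    nsq t zK.1.1 (zK.1.2.1 *m tau x zK.1.1) * nsq 0 zK.1.1 (zK.1.2.2 *m tau x zK.1.1)
    <= zK.2 * (nsq 0 zK.1.1 (zK.1.2.1 *m tau x zK.1.1) *
               nsq t zK.1.1 (zK.1.2.2 *m tau x zK.1.1)).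
  have HP : \forall zK \near filter_prod (nbhs (x, (u, w))) +oo,
      `[0, N]%classic `<=` P zK.
    apply: cov => t; rewrite /= in_itv/= => /andP[t0 tN].
    (* Continuity of the transported metric is known for nonnegative times, hence the one-sided
       neighbourhoods at t = 0. *)
    pose G := filter_prod (within [set t | 0 <= t] (nbhs t)) (nbhs (x, (u, w))).
    have FG : Filter G by apply: filter_prod_filter.
    have [c1 c2 c3] := point_cvg x u w.
    have sG : (fun tz : R * (M * ('rV[R]_n * 'rV[R]_n)) => tz.2) @ G -->
       (x, (u, w)) by exact: cvg_snd.
    have tG : (fun tz : R * (M * ('rV[R]_n * 'rV[R]_n)) => tz.1) @ G --> t.
      by apply: cvg_trans (@cvg_fst _ _ _ _ _) _; exact: cvg_within.
    have tge : \forall tz \near G, 0 <= tz.1.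
      apply: (@near_pair _ _ _ _ [set t | 0 <= t] setT) => //.
      - exact: withinT.
      - exact: filterT.
    have zG : \forall tz \near G, 0 <= (fun=> 0 : R) tz by exact: filterE.
    have c0 : (fun=> 0 : R) tz @[tz --> G] --> (0 : R) by exact: cvg_cst.
    have d1 := cvg_comp _ _ sG c1; have d2 := cvg_comp _ _ sG c2.
    have d3 := cvg_comp _ _ sG c3.
    have fG : nsq tz.1 tz.2.1 (tz.2.2.1 *m tau x tz.2.1) *
        nsq 0 tz.2.1 (tz.2.2.2 *m tau x tz.2.1) @[tz --> G] -->
        nsq t x u * nsq 0 x w.
      exact: cvgM (flow_dot_cvg hg hphi tG t0 tge d1 d2 d2)
      (flow_dot_cvg hg hphi c0 (lexx 0) zG d1 d3 d3).
    have hG : nsq 0 tz.2.1 (tz.2.2.1 *m tau x tz.2.1) *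
        nsq tz.1 tz.2.1 (tz.2.2.2 *m tau x tz.2.1) @[tz --> G] -->
        nsq 0 x u * nsq t x w.
      exact: cvgM (flow_dot_cvg hg hphi c0 (lexx 0) zG d1 d2 d2)
      (flow_dot_cvg hg hphi tG t0 tge d1 d3 d3).
    have h0 : 0 < nsq 0 x u * nsq t x w by rewrite mulr_gt0 ?nsq_gt0.
    have [K0 [[/= V1 V2] [/= nV1 nV2] V]] := cvg_le_mul_near fG hG h0.
    have nK : filter_prod (nbhs (x, (u, w))) +oo
        (fun zK : (M * ('rV[R]_n * 'rV[R]_n)) * R => V2 zK.1 /\ K0 <= zK.2).
      by apply: (near_pair nV2 (nbhs_pinfty_ge (num_real K0))).
    have {}nV1 : nbhs t (fun t' => 0 <= t' -> V1 t') by [].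
    apply: (near_pair nV1 nK) => t' [z K] V1t [/= V2z K0K].
    rewrite in_itv/= => /andP[t'0 _].
    exact: (V (t', z) (conj (V1t t'0) V2z)).
  apply: filterS HP => -[z K] /= H _ t tN; apply: (H t).
  by rewrite /= in_itv.
move=> H; have [K [K0 {}H]] := filter_ex (filterI (nbhs_pinfty_ge (num_real (0 : R))) H).
exists K => // x u w t Lx uE wF tN.
have [->|u0] := eqVneq u 0.
  by rewrite !nsq0 !mul0r mulr0.
have [->|w0] := eqVneq w 0.
  by rewrite !nsq0 !mulr0.
exact: H.
Qed.

Lemma exponential_domination : eventually_dominated ->
  exists K m : R, [/\ 0 < K, 0 < m & forall x u w t, Lam x ->
    (u <= E x)%MS -> (w <= F x)%MS -> 0 <= t ->
    nsq t x u * nsq 0 x w <= K * expR (- m * t) * (nsq 0 x u * nsq t x w)].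
Proof.
move=> /uniform_time[N HN].
have [K K0 HK] := bounded_distortion (ler0n R N.+1).
have N0 : 0 < N.+1%:R :> R by [].
have l0 : 0 < ln (4 : R) by apply: ln_gt0; lra.
(* The rate for which a step of length at most N, gaining a factor 4, always beats the exponential;
   [N.+1] keeps the denominator positive. *)
pose m := ln (4 : R) / N.+1%:R.
have m0 : 0 < m by rewrite divr_gt0.
have mN : expR (m * N.+1%:R) = 4 by rewrite divfK ?gt_eqF// lnK// posrE.
(* The factor 4 absorbs the exponential, which is at least 1/4 up to time N + 1; adding 1 makes the
   constant at least 1, as t = 0 requires. *)
exists (4 * (K + 1)), m; split => //; first by rewrite mulr_gt0// ltr_wpDl.
move=> x u w t Lx uE wF t0.
(* The induction is on an integer bound of t: each step takes off a time k of at least 1, which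
   depends on the current vectors. *)
have [j tj] : exists j : nat, t <= j%:R.
  by exists (Num.bound t); exact/ltW/archi_boundP.
elim: j => [|j IH] in x u w t Lx uE wF t0 tj *.
  have -> : t = 0 by apply/le_anti; rewrite t0 tj.
  rewrite mulr0 expR0 mulr1 ler_peMl ?mulr_ge0 ?nsq_ge0//; lra.
have [tN|Nt] := leP t N.+1%:R.
  have tN' : 0 <= t <= N.+1%:R by rewrite t0.
  apply: (le_trans (HK _ _ _ _ Lx uE wF tN')).
  rewrite ler_wpM2r ?mulr_ge0 ?nsq_ge0//.
  have : 1 <= 4 * expR (- m * t).
    rewrite -mN -expRD -[leLHS]expR0 ler_expR mulNr subr_ge0.
    by rewrite ler_pM2l.
  move=> e1; rewrite mulrAC (le_trans _ (ler_wpM2r _ e1)) ?addr_ge0//.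
  by rewrite mul1r lerDl.
have [->|u0] := eqVneq u 0; first by rewrite !nsq0 !mul0r mulr0.
have [->|w0] := eqVneq w 0; first by rewrite !nsq0 !mulr0.
have [k /andP[k0 kN] kH] := HN x u w Lx uE wF u0 w0.
have kR : 0 <= k%:R :> R by [].
have kN' : k%:R <= N.+1%:R :> R by rewrite ler_nat ltnW.
have tk0 : 0 <= t - k%:R by rewrite subr_ge0 (le_trans kN')// ltW.
have tkj : t - k%:R <= j%:R.
  by rewrite lerBlDr (le_trans tj)// -natrD ler_nat -addn1 leq_add2l.
have := IH _ _ _ _ (Lam_phi k%:R Lx) (subE_flow k%:R Lx uE)
  (subF_flow k%:R Lx wF) tk0 tkj.
rewrite !flow_dotD// subrK add0r.
have -> : - m * (t - k%:R) = m * k%:R - m * t by rewrite mulrBr !mulNr opprK addrC.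
rewrite expRD (mulrA _ (expR _)) => H1.
have e4 : expR (m * k%:R) <= 4 by rewrite -mN ler_expR ler_pM2l.
have c0 : 0 < nsq k%:R x w by exact: nsq_gt0.
have K4 : 0 <= 4 * (K + 1) by rewrite mulr_ge0// addr_ge0.
have et : 0 <= expR (- m * t) by exact: expR_ge0.
rewrite -mulNr in H1.
exact: (@ratio_step_le _ _ (expR (m * k%:R)) _ _ _ _ _ (nsq k%:R x u) (nsq k%:R x w)
  K4 (expR_ge0 _) e4 et (nsq_ge0 _ _ _) (nsq_ge0 _ _ _) (nsq_ge0 _ _ _) c0 H1 kH).
Qed.

Lemma eventual_dominated_splitting : eventually_dominated ->
  dominated_splitting A g D phi Lam E F.
Proof.
move=> /exponential_domination[K [m [K0 m0 H]]]; split=> //.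
(* Passing from squared norms to norms gives the square root of [K] and half of the rate; the extra
   factor 2 makes the inequality strict. *)
have sK : 0 < Num.sqrt K by rewrite sqrtr_gt0.
exists (2 * Num.sqrt K), (m / 2); split; [by rewrite mulr_gt0|by rewrite divr_gt0|].
move=> x t Lx /ltW t0.
have e0 : 0 < expR (- (m / 2) * t) by exact: expR_gt0.
apply: (@le_lt_trans _ _ (Num.sqrt K * expR (- (m / 2) * t))); last first.
  by rewrite ltr_pM2r// ltr_pMl// ltr1n.
have E2 : Num.sqrt K * expR (- (m / 2) * t) = Num.sqrt (K * expR (- m * t)).
  rewrite sqrtrM ?(ltW K0)//; congr (_ * _).
  rewrite -[LHS]ger0_norm ?(ltW e0)// -sqrtr_sqr; congr Num.sqrt.
  by rewrite expr2 -expRD; congr expR; field.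
have JK : J (- t) (phi t x) *m J t x = 1%:M.
  exact: mulmx1C (flow_derivK hphi x t0).
have [_ _ _ [_ Finv]] := hEF.
rewrite E2; apply: opnorm_mul_le => [|u w' uE u1 w'F w'1]; first exact: sqrtr_ge0.
rewrite (phiNK hphi)//; set w := w' *m _.
have wF : (w <= F x)%MS.
  by rewrite -[x in F x](phiNK hphi x t0) -(Finv (- t) _ (Lam_phi t Lx)) submxMr.
have w'E : w' = w *m J t x by rewrite -mulmxA JK mulmx1.
have := H x u w t Lx uE wF t0.
rewrite !flow_dot0 !flow_dotE -w'E => H1.
rewrite -sqrtrM ?gdot_ge0// ler_sqrt ?mulr_ge0 ?expR_ge0 ?(ltW K0)//.
apply: (le_trans H1); rewrite ler_piMr ?mulr_ge0 ?expR_ge0 ?(ltW K0)//.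
rewrite -!metric_norm_sqr// -(mulr1 1) ler_pM ?sqr_ge0//.
  by rewrite expr_le1// sqrtr_ge0.
by rewrite expr_le1// sqrtr_ge0.
Qed.

(** At a singularity the strict inequality at time T spreads to a neighbourhood. At any other point
    the speed stays above half its value nearby, so for small d no neighbour satisfies
    [speed < d]. *)
Lemma near_singular_domination :
  dominated_at_singularities A g X D phi Lam E F ->
  exists T, (0 < T)%N /\ exists2 d : R, 0 < d &
    forall x u w, Lam x -> speed x < d -> (u <= E x)%MS -> (w <= F x)%MS ->
    u != 0 -> w != 0 -> 4 * (nsq T%:R x u * nsq 0 x w) < nsq 0 x u * nsq T%:R x w.
Proof.
move=> /singular_domination[C [l [C0 l0 H]]].
(* T is chosen so that the domination factor at the singularities is below 1/4 at time T. *)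
have e4 : 0 < (4 : R)^-1 by rewrite invr_gt0.
have [T T0 /(_ T (leqnn T)) HT] := expR_decay_lt (ltW C0) l0 e4.
exists T; split => //.
pose Q (d : R) y u w := speed y < d ->
  4 * (nsq T%:R y u * nsq 0 y w) < nsq 0 y u * nsq T%:R y w.
have : \forall d \near (0:R)^'+, forall x u w, Lam x ->
    (u <= E x)%MS -> (w <= F x)%MS -> u != 0 -> w != 0 -> Q d x u w.
  apply: (splitting_compact hphi Lam_compact hEF).
    move=> d y u w a b a0 b0 yQ yd; rewrite !flow_dotZ.
    exact/ltr_scale/yQ.
  move=> x u w Lx uE wF u0 w0.
  have [c1 c2 _] := flow_dot_near x u w (lexx 0).
  have [c3 c4 _] := flow_dot_near x u w (ler0n R T).
  have [Xx|Xx] := eqVneq (X x) 0.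
    have lt1 : 4 * (nsq T%:R x u * nsq 0 x w) < nsq 0 x u * nsq T%:R x w.
      have p0 : 0 < nsq 0 x u * nsq T%:R x w by rewrite mulr_gt0 ?nsq_gt0.
      rewrite mulrC -ltr_pdivlMr// (le_lt_trans (H _ _ _ _ Lx Xx (ler0n R T) uE wF))//.
      by rewrite [ltRHS]mulrC ltr_pM2r.
    have Z : \forall z \near nbhs (x, (u, w)),
        4 * (nsq T%:R z.1 (z.2.1 *m tau x z.1) * nsq 0 z.1 (z.2.2 *m tau x z.1)) <
        nsq 0 z.1 (z.2.1 *m tau x z.1) * nsq T%:R z.1 (z.2.2 *m tau x z.1).
      exact: (cvg_lt_near (cvgM (cvg_cst (4 : R)) (cvgM c3 c2)) (cvgM c1 c4) lt1).
    by apply: (near_pair Z (nbhs_right_gt (0 : R))) => z d zZ _ _ _.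
  have sx : 0 < speed x by exact: gdot_gt0.
  have sc : speed z.1 @[z --> nbhs (x, (u, w))] --> speed x.
    have c : speed y @[y --> x] --> speed x.
      by apply: cvg_mx_entry; exact: (vf_norm_cvg hphi hg hX).
    by have [d1 _ _] := point_cvg x u w; exact: cvg_comp d1 c.
  have lt1 : speed x / 2 < speed x by lra.
  have Z : \forall z \near nbhs (x, (u, w)), speed x / 2 < speed z.1.
    exact: (cvg_lt_near (cvg_cst _) sc lt1).
  have sx2 : 0 < speed x / 2 by rewrite divr_gt0.
  apply: (near_pair Z (nbhs_right_lt sx2)) => z d zZ /= dx _ zd.
  by have := lt_trans (lt_trans zZ zd) dx; rewrite ltxx.
move=> H1; have [d [d0 {}H1]] := filter_ex (filterI (nbhs_right_gt (0 : R)) H1).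
by exists d => // x u w Lx sd uE wF u0 w0; exact: H1.
Qed.

(** Gram determinants of the basis u, v: the squared area at time t is at most the product of the
    squared lengths, and at least [C ^+ 2] times the initial squared area, the exponential being at
    least 1. *)
Lemma area_expansion : sectionally_expanding A g D phi Lam F ->
  exists C l : R, [/\ 0 < C, 0 < l & forall x u v t, Lam x ->
    (u <= F x)%MS -> (v <= F x)%MS -> v != 0 -> ~~ (u <= v)%MS -> 0 < t ->
    C * (nsq 0 x u * nsq 0 x v - gd 0 x u v ^+ 2) <= nsq t x u * nsq t x v].
Proof.
move=> [_ [C [l [C0 l0 H]]]]; exists (C ^+ 2), l; split => //; first by rewrite exprn_gt0.
move=> x u v t Lx uF vF v0 uv t0.
set B := col_mx u v; pose L := <<B>>%MS.
have fB : row_free B.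
  apply: inj_row_free => c; rewrite -[c]hsubmxK mul_row_col.
  set a := lsubmx c; set b := rsubmx c.
  rewrite [a]mx11_scalar [b]mx11_scalar !mul_scalar_mx => E0.
  have a0 : a ord0 ord0 = 0.
    apply/eqP; apply: contraNT uv => a0; apply/sub_rVP.
    exists (- (a ord0 ord0)^-1 * b ord0 ord0).
    move/eqP: E0; rewrite addr_eq0 => /eqP E0.
    by rewrite -scalerA scaleNr -scalerN -E0 scalerA mulVf// scale1r.
  move: E0; rewrite a0 scale0r add0r => /eqP; rewrite scaler_eq0 (negPf v0) orbF.
  by move=> /eqP ->; rewrite !raddf0 row_mx0.
have BL : (B :=: L)%MS by apply: eqmx_sym; exact: genmxE.
have rL : \rank L = 2%N by rewrite -BL; exact/eqP.
have LF : (L <= F x)%MS by rewrite -BL col_mx_sub uF vF.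
have := H x L Lx LF rL t t0.
rewrite (absdetE _ _ _ fB BL) mul_col_mx !det_gram2//.
rewrite !flow_dot0 !flow_dotE.
set p := gdot (g x) u u * _ - _; set q := _ * _ - _ => H1.
have p0 : 0 < p by rewrite subr_gt0 cauchy_schwarz_strict.
have Ce : 0 < C * expR (l * t) by rewrite mulr_gt0// expR_gt0.
have qp : 0 < q / p by rewrite -sqrtr_gt0 (lt_trans Ce).
have : C ^+ 2 <= q / p.
  rewrite -[q / p]sqr_sqrtr ?(ltW qp)// ler_pXn2r ?nnegrE ?sqrtr_ge0 ?(ltW C0)//.
  rewrite (le_trans _ (ltW H1))// ler_peMr ?(ltW C0)// -expR0 ler_expR.
  by rewrite mulr_ge0// ltW.
by rewrite ler_pdivlMr// => /le_trans; apply; rewrite /q gerBl sqr_ge0.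
Qed.

Lemma eventually_dominatedP :
  uniformly_contracted A g D phi Lam E -> sectionally_expanding A g D phi Lam F ->
  dominated_at_singularities A g X D phi Lam E F -> eventually_dominated.
Proof.
move=> hE hF hsing x u w Lx uE wF u0 w0; apply: contrapT => bad.
have {}bad k : (0 < k)%N ->
    nsq 0 x u * nsq k%:R x w <= 4 * (nsq k%:R x u * nsq 0 x w).
  by move=> k0; rewrite leNgt; apply/negP => lt; apply: bad; exists k.
have [T [T0 [d d0 HT]]] := near_singular_domination hsing.
have u00 : 0 < nsq 0 x u by exact: nsq_gt0.
have w00 : 0 < nsq 0 x w by exact: nsq_gt0.
have [Xx|Xx] := eqVneq (X x) 0.
  have sx : speed x < d by rewrite Xx /gdot !mul0mx mxE.
  by have := HT x u w Lx sx uE wF u0 w0; rewrite ltNge bad.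
have [C [l [C0 l0 HC]]] := contraction hE.
have wdecay k : (0 < k)%N -> nsq k%:R x w <= 4 * C * nsq 0 x w * expR (- l * k%:R).
  move=> k0; rewrite -(ler_pM2l u00) (le_trans (bad k k0))//.
  have := HC x k%:R u Lx (ler0n R k) uE => /(ler_wpM2r (ltW w00)) H.
  have := ler_wpM2l (ler0n R 4) H => {}H; apply: (le_trans H).
  by rewrite le_eqVlt; apply/orP; left; apply/eqP; ring.
have XF : (X x <= F x)%MS by exact: vf_subF.
have speedE k : speed (phi k%:R x) = nsq k%:R x (X x).
  by rewrite flow_dotE (vf_flow hphi (Lam_dom Lx)).
(* Otherwise the product of the decaying squared norm of DX_k w and the bounded squared speed would
   dominate a fixed positive squared area. *)
have wX : (w <= X x)%MS.
  apply: contrapT => /negP nwX.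
  have [C' [l' [C'0 l'0 HA]]] := area_expansion hF.
  have [K K0 HK] := vf_bounded.
  have a0 : 0 < C' * (nsq 0 x w * nsq 0 x (X x) - gd 0 x w (X x) ^+ 2).
    by rewrite mulr_gt0// subr_gt0 !flow_dot0 cauchy_schwarz_strict.
  have := @expR_decay_le0 R _ (4 * C * nsq 0 x w * K) l l0.
  move=> /(_ (C' * (nsq 0 x w * nsq 0 x (X x) - gd 0 x w (X x) ^+ 2))).
  rewrite leNgt a0 => /(_ _)/negP; apply => // k k0.
  apply: (le_trans (HA _ _ _ k%:R Lx wF XF Xx nwX _)); first by rewrite ltr0n.
  rewrite -speedE mulrAC ler_pM ?nsq_ge0 ?gdot_ge0 ?wdecay// HK//.
  exact: Lam_phi.
have [a wE] := sub_rVP wX.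
have a0 : a != 0 by apply: contra w0 => /eqP a0; rewrite wE a0 scale0r.
have a2 : 0 < a ^+ 2 by rewrite exprn_even_gt0.
(* As w = a X(x), the squared norm of DX_k w is a^2 times the squared speed at X_k(x); the threshold
   a^2 d therefore yields speed below d from time k0 on. *)
have [k0 k00 Hk0] := expR_decay_lt (mulr_ge0 (mulr_ge0 (ler0n R 4) (ltW C0)) (ltW w00))
  l0 (mulr_gt0 a2 d0).
have slow k : (k0 <= k)%N -> speed (phi k%:R x) < d.
  move=> kk; have := le_lt_trans (wdecay k (leq_trans k00 kk)) (Hk0 k kk).
  rewrite wE flow_dotZ speedE -expr2 ltr_pM2l//.
(* All points X_k(x) with k at least k0 are slow, so the domination near singularities applies at
   every step of length T and the factors 4 multiply. *)
have iter m : 4 ^+ m * (nsq (k0 + m * T)%:R x u * nsq k0%:R x w) <=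
    nsq k0%:R x u * nsq (k0 + m * T)%:R x w.
  elim: m => [|m IH]; first by rewrite mul0n addn0 expr0 mul1r.
  set k := (k0 + m * T)%N in IH *.
  have -> : (k0 + m.+1 * T = T + k)%N by rewrite mulSn addnCA.
  have kk : (k0 <= k)%N by exact: leq_addr.
  have kR : 0 <= k%:R :> R by [].
  have uk := mulmx_flow_neq0 x kR u0; have wk := mulmx_flow_neq0 x kR w0.
  have := HT _ _ _ (Lam_phi k%:R Lx) (slow k kk) (subE_flow k%:R Lx uE)
    (subF_flow k%:R Lx wF) uk wk.
  rewrite !flow_dotD// add0r -natrD exprS => step.
  have q0 : 0 <= (4 : R) ^+ m by rewrite exprn_ge0.
  exact: (ratio_pow_step q0 IH (nsq_ge0 _ _ _) (nsq_gt0 x kR w0) (nsq_gt0 x kR u0)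
    (nsq_ge0 _ _ _) step).
have u1 : 0 < nsq k0%:R x u by exact: nsq_gt0.
have w1 : 0 < nsq k0%:R x w by exact: nsq_gt0.
(* The largest value of 4^m compatible with the assumption at time k0 + mT. It does not depend on m,
   so an m above r suffices, since m < 4^m. *)
pose r := (4 * (nsq k0%:R x u * nsq 0 x w)) / (nsq k0%:R x w * nsq 0 x u).
have [m rm] : exists m : nat, r < m%:R.
  exists (Num.bound r); apply: archi_boundP.
  by rewrite divr_ge0 ?mulr_ge0 ?(ltW u1) ?(ltW w1) ?(ltW u00) ?(ltW w00).
have : 4 ^+ m <= r.
  rewrite ler_pdivlMr ?mulr_gt0//.
  have kpos : (0 < k0 + m * T)%N by rewrite addn_gt0 k00.
  have p0 : 0 < nsq (k0 + m * T)%:R x u by exact: nsq_gt0.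
  exact: (ratio_pow_bound u00 u1 p0 (iter m) (bad _ kpos)).
apply/negP; rewrite -ltNge (lt_trans rm)//.
by rewrite -natrX ltr_nat ltn_expl.
Qed.

End Domination.

Theorem theorem1 (R : realType) (n : nat) (hn : (3 <= n)%N)
  (M : topologicalType) (A : smooth_atlas R n M)
  (M_hausdorff : hausdorff_space M)
  (M_compact : compact [set: M]) (M_connected : connected [set: M])
  (g : M -> 'M[R]_n) (hg : riemannian_metric A g)
  (X : M -> 'rV[R]_n) (hX : C1_vector_field A X)
  (hin : inwardly_transverse A X)
  (D : R -> set M) (phi : R -> M -> M) (hphi : is_flow A X D phi)
  (Lam : set M) (Lam_compact : compact Lam)
  (Lam_invariant : invariant_set D phi Lam)
  (Lam_hyperbolic : forall s, Lam s -> singularity X s -> hyperbolic A X s)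
  (E F : M -> 'M[R]_n)
  (hEF : invariant_splitting A D phi Lam E F)
  (hE : uniformly_contracted A g D phi Lam E)
  (hF : sectionally_expanding A g D phi Lam F)
  (hsing : dominated_at_singularities A g X D phi Lam E F) :
  dominated_splitting A g D phi Lam E F.
Proof.
apply: (eventual_dominated_splitting hg hphi Lam_compact Lam_invariant hEF).
exact: (eventually_dominatedP hg hX hphi Lam_compact Lam_invariant hEF).
Qed.
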